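(* Let $U\subseteq\mathbb K^n$ be open, let $f:U\to\mathbb K^n$ be smooth, and let $\gamma_1,\ldots,\gamma_s:U\to\mathbb K$ be smooth functions. (a) The differential equation $\dot x=f(x)$ admits the algebraic side conditions $\gamma_1=\cdots=\gamma_s=0$ only if the set of functions $$\{X_f^k(\gamma_j);\ k\ge 0,\ 1\le j\le s\}=\{\gamma_1,\ldots,\gamma_s,\,X_f(\gamma_1),\ldots,X_f(\gamma_s),\,X_f^2(\gamma_1),\ldots\}$$ has a common zero in $U$. (b) If $f$ and all $\gamma_j$ are analytic (or polynomial), the converse holds: whenever the common zero set $\widetilde W\subseteq U$ of all the functions $X_f^k(\gamma_j)$ ($k\geq 0$, $1\leq j\leq s$) is not empty, then $\widetilde W$ is invariant for $\dot x=f(x)$ (and hence the equation admits the algebraic side conditions $\gamma_1=\cdots=\gamma_s=0$).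
   Context: $\mathbb K$ is $\mathbb R$ or $\mathbb C$. For a smooth vector field $f$ on $U$, $X_f$ denotes the derivation $X_f(\psi)(x)=D\psi(x)f(x)$ acting on smooth scalar-valued functions $\psi$, and $X_f^k$ is its $k$-fold iterate ($X_f^0(\psi)=\psi$). A subset of $U$ is invariant for $\dot x=f(x)$ if every solution in $U$ starting in the subset remains in it as long as it exists. The equation $\dot x=f(x)$ is said to admit the algebraic side conditions $\gamma_1=\cdots=\gamma_s=0$ if there exists a solution trajectory of the equation which is contained in the common zero set $W$ of $\gamma_1,\ldots,\gamma_s$ (the whole of $W$ is not required to be invariant). *)

(* Defs.v *)
From mathcomp Require Import all_boot all_order all_algebra.
From mathcomp Require Import all_classical all_reals all_analysis.
From mathcomp Require Import complex.
From mathcomp Require mpoly.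

Set Implicit Arguments.
Unset Strict Implicit.
Unset Printing Implicit Defensive.

Import Order.TTheory GRing.Theory Num.Theory.
Import numFieldNormedType.Exports.

Local Open Scope classical_set_scope.
Local Open Scope ring_scope.

Variant scalar_kind := RealScalars | ComplexScalars.

Definition scalars (R : realType) (k : scalar_kind) : numFieldType :=
  match k with
  | RealScalars => R
  | ComplexScalars => R[i]%C
  end.

(* Maps defined on an open set U are represented by total functions; every
   notion below only depends on their values on U. Differentiability is always
   over K, so for complex scalars "smooth" means holomorphic. *)
Section Regularity.
Context {K : numFieldType} {n : nat} {V : normedModType K}.
Implicit Types (U : set 'rV[K]_n) (g : 'rV[K]_n -> V).

Fixpoint C_on (k : nat) U g : Prop :=
  match k with
  | 0 => forall x, U x -> {for x, continuous g}
  | k'.+1 => (forall x, U x -> differentiable g x) /\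
             forall v, C_on k' U ('D_v g)
  end.

Definition smooth_on U g : Prop := forall k, C_on k U g.

(* Partial sum, over the exponents alpha with all alpha_i < N, of the power
   series with coefficients c. *)
Definition power_sum (c : ('I_n -> nat) -> V) (N : nat) (h : 'rV[K]_n) : V :=
  \sum_(alpha : {ffun 'I_n -> 'I_N})
    (\prod_(i < n) h 0 i ^+ alpha i) *: c (fun i => nat_of_ord (alpha i)).

(* The first condition is absolute convergence of the series on the closed
   polydisc of radius r; `|h| is the maximum norm. *)
Definition analytic_at g (a : 'rV[K]_n) : Prop :=
  exists (c : ('I_n -> nat) -> V) (r M : K),
    [/\ 0 < r,
        forall N, \sum_(alpha : {ffun 'I_n -> 'I_N})
          `|c (fun i => nat_of_ord (alpha i))| * r ^+ (\sum_(i < n) alpha i)%N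
            <= M
      & forall h, `|h| < r -> power_sum c N h @[N --> \oo] --> g (a + h)].

Definition analytic_on U g : Prop := forall a, U a -> analytic_at g a.

End Regularity.

Section Polynomial.
Context {K : numFieldType} {n : nat}.
Implicit Type U : set 'rV[K]_n.

Definition polynomial_on U (psi : 'rV[K]_n -> K) : Prop :=
  exists p : mpoly.mpoly n K,
    forall x, U x -> psi x = mpoly.meval (fun i => x 0 i) p.

Definition polynomial_field_on U (f : 'rV[K]_n -> 'rV[K]_n) : Prop :=
  forall i, polynomial_on U (fun x => f x 0 i).

End Polynomial.

Section DifferentialEquation.
Context {K : numFieldType} {n : nat}.
Implicit Types (T D : set K) (U W : set 'rV[K]_n) (f : 'rV[K]_n -> 'rV[K]_n).

(* X_f *)
Definition lie_derivative f (psi : 'rV[K]_n -> K) : 'rV[K]_n -> K :=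
  fun x => 'd psi x (f x).

(* The set in which time varies: the real line or all of K. Both choices
   coincide over the reals; over the complex numbers they give real-time and
   complex-time solutions. *)
Definition time_axis T : Prop :=
  T = [set t | t \is Num.real] \/ T = [set: K].

(* The nonempty connected relatively open subsets of the time axis, that is
   the open intervals when T is the real line. *)
Definition time_domain T D : Prop :=
  [/\ D !=set0, connected D & exists2 O : set K, open O & D = O `&` T].

Definition solution T D U f (x : K -> 'rV[K]_n) : Prop :=
  forall t, D t ->
    U (x t) /\
    (fun h : K => h^-1 *: (x (t + h) - x t)) @ within T 0^' --> f (x t).

Definition flow_invariant T U f W : Prop :=
  forall D x, time_domain T D -> solution T D U f x ->
  forall t0 t, D t0 -> D t -> W (x t0) -> W (x t).

Definition admits_side_conditions T U f s
    (gamma : 'I_s -> 'rV[K]_n -> K) : Prop :=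
  exists D x, [/\ time_domain T D, solution T D U f x
    & forall t, D t -> forall j, gamma j (x t) = 0].

Definition lie_common_zeros U f s (gamma : 'I_s -> 'rV[K]_n -> K) :
    set 'rV[K]_n :=
  [set x | U x /\ forall k j, iter k (lie_derivative f) (gamma j) x = 0].

End DifferentialEquation.

(* Main.v *)
Require Import Defs.
From HB Require Import structures.
From mathcomp Require Import all_boot all_order all_algebra.
From mathcomp Require Import all_classical all_reals all_analysis.
From mathcomp Require Import complex.
From mathcomp Require mpoly.
From mathcomp Require Import ring.
Import Order.TTheory GRing.Theory Num.Theory.
Import numFieldNormedType.Exports.
Local Open Scope classical_set_scope.
Local Open Scope ring_scope.

(** Along a solution x of x' = f(x) the derivative of psi(x(t)) is
    (X_f psi)(x(t)).  If psi(x(t)) vanishes for all times then so does its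
    derivative, hence (X_f psi)(x(t)), and by iteration every
    (X_f^k psi)(x(t)): each point of the trajectory is a common zero of the
    functions X_f^k(gamma_j), which is part (a).

    Part (b) rests on one estimate: near every point of U there are constants
    C and L with |X_f^k g| <= C L^k k! for all k, when f and g are analytic or
    polynomial ([lie_bounds]).  It is obtained by Cauchy's majorant method.
    Say that g is majorized by C (1 - A t)^(-m) on B when every partial
    derivative of g of order b is bounded on B by the b-th derivative of that
    function at t = 0.  Products multiply the constants and add the exponents
    m, a partial derivative raises m by 1, so X_f raises m by 2, and the
    resulting constants are explicit ([majorized_mul],
    [majorized_iter_lie]).  A polynomial is majorized because coordinates are;
    an analytic function because its partial sums are, uniformly, and bounds
    on all derivatives pass to pointwise limits ([partial_limit_le]).

    Invariance: if all e_k(t) = (X_f^k gamma_j)(x(t)) vanish at t0, then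
    e_k' = e_(k+1) and Taylor's estimate with |e_k| <= C L^k k! gives
    |e_0(t)| <= C (L |t - t0|)^m for every m, so e_0 = 0 near t0
    ([taylor_vanish]).  The set of times spent in the common zero set is thus
    open in the time domain; it is closed by continuity, and the time domain is
    connected ([lie_zeros_invariant]).

    It remains to produce a solution through a common zero a
    ([local_solution]).  The candidate is the Lie series
    x(t) = sum_k (X_f^k id)(a) t^k / k!, convergent by the same estimate.  The
    defects e_k(t) = (X_f^k f)(x(t)) - sum_j (X_f^(k+j) f)(a) t^j / j! vanish
    at 0 and satisfy e_k' = e_(k+1) - D(X_f^k f)(x) e_0, and e_0 = 0 says that
    x solves the equation.  Taylor's estimate with this remainder turns a bound
    eta for e_0 on a small disc into the bound eta / 2, whence e_0 = 0.

    Real and complex scalars, and real and complex time, are treated together: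
    the only analytic input is a mean value inequality along the segments of
    the time axis ([increment_le]), which reduces to the real mean value
    theorem by taking real parts. *)

Set Implicit Arguments.
Unset Strict Implicit.
Unset Printing Implicit Defensive.

(** * Smooth functions and Lie derivatives *)

Section SmoothCalculus.
Context {K : numFieldType} {n : nat}.
Implicit Types (U : set 'rV[K]_n) (x y v : 'rV[K]_n).

Lemma near_open_eq (W : Type) U (g g' : 'rV[K]_n -> W) x :
  open U -> U x -> (forall y, U y -> g y = g' y) -> \near x, g x = g' x.
Proof.
move=> oU Ux gg'; apply: filterS gg' _.
exact: open_nbhs_nbhs.
Qed.

Lemma near_eq_differentiable (V W : normedModType K) (g g' : V -> W) (x : V) :
  (\near x, g x = g' x) -> differentiable g x -> differentiable g' x.
Proof.
move=> gg' /diff_locallyP[dc dE]; rewrite (_ : g' = g + (g' - g)); last first.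
  by apply/funext => y /=; rewrite !fctE addrC subrK.
apply: differentiableD; first exact/diff_locallyP.
pose z : {linear V -> W} := \0.
have hz : 'd (g' - g) x = z :> (V -> W).
  apply: diff_unique; first by move=> y; exact: cst_continuous.
  apply/eqaddoP => e e0.
  have := gg'; rewrite (near_shift 0) subr0 => H.
  apply: filterS H => y /= H;
    rewrite !fctE /= H (nbhs_singleton gg') !subrr addr0 subr0 normr0.
  by rewrite mulr_ge0 // ltW.
apply/diff_locallyP; rewrite hz; split; first by move=> y; exact: cst_continuous.
apply/eqaddoP => e e0.
have := gg'; rewrite (near_shift 0) subr0 => H.
apply: filterS H => y /= H;
  rewrite !fctE /= H (nbhs_singleton gg') !subrr addr0 subr0 normr0.
by rewrite mulr_ge0 // ltW.
Qed.

(** All notions of regularity on U must be insensitive to the values of a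
    function off U, since derivatives of products and sums are computed by the
    usual formulas only on U. *)
Lemma C_on_eq (V : normedModType K) k U (g g' : 'rV[K]_n -> V) : open U ->
  (forall y, U y -> g y = g' y) -> C_on k U g -> C_on k U g'.
Proof.
move=> oU; elim: k g g' => [|k IH] g g' gg' /=.
  move=> gc x Ux; have ngg' := near_open_eq oU Ux gg'.
  rewrite /prop_for /continuous_at -(gg' _ Ux).
  apply: cvg_trans (gc _ Ux); apply: (@near_eq_cvg _ _ (nbhs x)).
  by apply: filterS ngg' => y /= ->.
move=> [gd gD]; split.
  move=> x Ux; apply: near_eq_differentiable (gd _ Ux).
  exact: near_open_eq gg'.
move=> v; apply: IH (gD v) => y Uy; apply: near_eq_derive.
exact: near_open_eq gg'.
Qed.

Lemma smooth_on_eq (V : normedModType K) U (g g' : 'rV[K]_n -> V) : open U ->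
  (forall y, U y -> g y = g' y) -> smooth_on U g -> smooth_on U g'.
Proof. by move=> oU gg' sg k; exact: C_on_eq gg' (sg k). Qed.

Lemma C_on_sub (V : normedModType K) k U U' (g : 'rV[K]_n -> V) :
  U' `<=` U -> C_on k U g -> C_on k U' g.
Proof.
move=> UU'; elim: k g => [|k IH] g /=; first by move=> gc x /UU' /gc.
by move=> [gd gD]; split=> [x /UU' /gd//|v]; apply: IH.
Qed.

Lemma smooth_on_sub (V : normedModType K) U U' (g : 'rV[K]_n -> V) :
  U' `<=` U -> smooth_on U g -> smooth_on U' g.
Proof. by move=> UU' sg k; exact: C_on_sub UU' (sg k). Qed.

Lemma smooth_on_differentiable (V : normedModType K) U (g : 'rV[K]_n -> V) x :
  smooth_on U g -> U x -> differentiable g x.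
Proof. by move=> /(_ 1%N)[+ _] Ux; apply. Qed.

Lemma smooth_on_derivable (V : normedModType K) U (g : 'rV[K]_n -> V) x v :
  smooth_on U g -> U x -> derivable g x v.
Proof. by move=> sg Ux; exact/diff_derivable/(smooth_on_differentiable sg). Qed.

Lemma smooth_on_derive (V : normedModType K) U (g : 'rV[K]_n -> V) v :
  smooth_on U g -> smooth_on U ('D_v g).
Proof. by move=> sg k; have [_] := sg k.+1; apply. Qed.

Lemma C_on_add (V : normedModType K) k U (g h : 'rV[K]_n -> V) : open U ->
  C_on k U g -> C_on k U h -> C_on k U (g + h).
Proof.
move=> oU; elim: k g h => [|k IH] g h /=.
  by move=> cg ch x Ux;
    exact: (@cvgD _ _ _ (nbhs x) _ _ _ _ _ (cg _ Ux) (ch _ Ux)).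
move=> [dg Dg] [dh Dh]; split=> [x Ux|v].
  by apply: differentiableD; [exact: dg|exact: dh].
apply: C_on_eq (IH _ _ (Dg v) (Dh v)) => // y Uy.
by rewrite deriveD //; apply: diff_derivable; [exact: dg|exact: dh].
Qed.

Lemma smooth_on_add (V : normedModType K) U (g h : 'rV[K]_n -> V) : open U ->
  smooth_on U g -> smooth_on U h -> smooth_on U (g + h).
Proof. by move=> oU sg sh k; exact: C_on_add. Qed.

Lemma smooth_on_mul U (g h : 'rV[K]_n -> K) : open U ->
  smooth_on U g -> smooth_on U h -> smooth_on U (g * h).
Proof.
move=> oU sg sh k; elim: k g h sg sh => [|k IH] g h sg sh /=.
  move=> x Ux; apply: differentiable_continuous.
  apply: differentiableM; exact: smooth_on_differentiable Ux.
split=> [x Ux|v].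
  apply: differentiableM; exact: smooth_on_differentiable Ux.
apply: (@C_on_eq _ k U (g * 'D_v h + h * 'D_v g)) => //.
  move=> y Uy; rewrite deriveM //; exact: smooth_on_derivable Uy.
by apply: C_on_add => //; apply: IH => //; exact: smooth_on_derive.
Qed.

Lemma smooth_on_cst (V : normedModType K) U (c : V) : open U ->
  smooth_on U (cst c).
Proof.
move=> oU k; elim: k c => [|k IH] c /=; first by move=> x _;
  exact: cst_continuous.
split=> [x Ux|v]; first exact: differentiable_cst.
by apply: C_on_eq (IH 0) => // y Uy; rewrite derive_cst.
Qed.

Lemma smooth_on_sum (I : Type) (r : seq I) (P : pred I) U
    (g : I -> 'rV[K]_n -> K) : open U ->
  (forall i, P i -> smooth_on U (g i)) -> smooth_on U (\sum_(i <- r | P i) g i).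
Proof.
move=> oU sg; elim/big_ind: _ => //; last by move=> ? ?; exact: smooth_on_add.
exact: smooth_on_cst.
Qed.

Lemma derive_coord (g : 'rV[K]_n -> 'rV[K]_n) x v i : differentiable g x ->
  'D_v (fun y => g y 0 i) x = 'D_v g x 0 i.
Proof.
move=> dg; rewrite !deriveE //; last first.
  exact: (differentiable_comp dg (differentiable_coord _ _ _)).
have lin : linear (fun N : 'rV[K]_n => N 0 i) by move=> a u w; rewrite !mxE.
pose cM := GRing.isLinear.Build _ _ _ _ _ lin.
pose c : {linear 'rV[K]_n -> K} := HB.pack (fun N : 'rV[K]_n => N 0 i) cM.
have dc := @diff_lin _ _ _ c (g x) (@coord_continuous K 1 n 0 i).
have dE := @diff_comp _ _ _ _ g c x dg (differentiable_coord (g x) 0 i).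
apply: etrans (congr1 (fun h : 'rV[K]_n -> K => h v) dE) _.
exact: (congr1 (fun h : 'rV[K]_n -> K => h ('d g x v)) dc).
Qed.

Lemma smooth_on_coord U (g : 'rV[K]_n -> 'rV[K]_n) i : open U ->
  smooth_on U g -> smooth_on U (fun y => g y 0 i).
Proof.
move=> oU sg k; elim: k g sg => [|k IH] g sg /=.
  move=> x Ux; apply: differentiable_continuous.
  apply: differentiable_comp (differentiable_coord _ _ _).
  exact: smooth_on_differentiable Ux.
split=> [x Ux|v].
  apply: differentiable_comp (differentiable_coord _ _ _).
  exact: smooth_on_differentiable Ux.
apply: C_on_eq (IH _ (smooth_on_derive v sg)) => //= y Uy.
rewrite derive_coord //; exact: smooth_on_differentiable Uy.
Qed.

Lemma smooth_on_id U : open U -> smooth_on U (@id 'rV[K]_n).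
Proof.
move=> oU [|k] /=; first by move=> x _; exact: cvg_id.
split=> [x _|v].
  by have := is_diff_id x; case.
apply: (@C_on_eq _ k U (cst v)) => //; last exact: smooth_on_cst.
by move=> y _; rewrite derive_id.
Qed.

(** X_f as a first-order operator in coordinates; this is what lets the
    majorant calculus, which only knows partial derivatives, apply to X_f. *)
Lemma lie_derivativeE U f (g : 'rV[K]_n -> K) x : smooth_on U g -> U x ->
  lie_derivative f g x = \sum_(i < n) f x 0 i * 'D_(delta_mx 0 i) g x.
Proof.
move=> sg Ux; have dg := smooth_on_differentiable sg Ux.
rewrite /lie_derivative {1}(row_sum_delta (f x)) linear_sum /=.
by apply: eq_bigr => i _; rewrite linearZ /= deriveE.
Qed.

Lemma smooth_on_lie_derivative U f (g : 'rV[K]_n -> K) : open U ->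
  smooth_on U f -> smooth_on U g -> smooth_on U (lie_derivative f g).
Proof.
move=> oU sf sg.
apply: (@smooth_on_eq _ U (\sum_(i < n) (fun y => f y 0 i) * 'D_(delta_mx 0 i)
  g)) => //.
  by move=> y Uy; rewrite (lie_derivativeE _ sg Uy) fct_sumE.
apply: smooth_on_sum => // i _; apply: smooth_on_mul => //.
  exact: smooth_on_coord.
exact: smooth_on_derive.
Qed.

Lemma smooth_on_iter_lie U f (g : 'rV[K]_n -> K) k : open U ->
  smooth_on U f -> smooth_on U g -> smooth_on U (iter k (lie_derivative f) g).
Proof.
by move=> oU sf sg; elim: k => //= k; exact: smooth_on_lie_derivative.
Qed.

End SmoothCalculus.

(** * Majorants *)

Fixpoint rising (m b : nat) : nat :=
  if b is b'.+1 then (m * rising m.+1 b')%N else 1%N.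

Lemma rising1 b : rising 1 b = b`!.
Proof.
suff H m : (m`! * rising m.+1 b = (m + b)`!)%N by rewrite -(H 0%N) mul1n.
elim: b m => [|b IH] m /=; first by rewrite muln1 addn0.
by rewrite mulnA (mulnC m`!) -factS IH addSnnS.
Qed.

Lemma rising_last m b : rising m b.+1 = (rising m b * (m + b))%N.
Proof.
elim: b m => [|b IH] m; first by rewrite /= muln1 mul1n addn0.
by rewrite [LHS]/= -[(_ * rising _ b)%N]/(rising m.+1 b.+1) IH mulnA addSnnS.
Qed.

Lemma leq_rising m m' b : (m <= m')%N -> (rising m b <= rising m' b)%N.
Proof. by elim: b m m' => //= b IH m m' mm'; rewrite leq_mul // IH. Qed.

Lemma rising_pascal m b :
  rising m.+1 b.+1 = (rising m b.+1 + b.+1 * rising m.+1 b)%N.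
Proof. by rewrite rising_last /= -mulnDl mulnC addSnnS. Qed.

(** Since rising m b / b! is the binomial coefficient of m + b - 1 over b, it is
    at most 2^(m + b); Pascal's rule gives this by induction. *)
Lemma rising_bound m b : (rising m b <= 2 ^ (m + b) * b`!)%N.
Proof.
elim: b m => [|b IHb] m; first by rewrite /= fact0 muln1 expn_gt0.
elim: m => [|m IHm]; first by [].
rewrite rising_pascal;
  apply: leq_trans (leq_add IHm (leq_mul (leqnn _) (IHb m.+1))) _.
by rewrite addSnnS factS mulnCA addnn -mul2n addSn expnS -!mulnA (mulnCA b.+1).
Qed.

Section Majorants.
Context {K : numFieldType} {n : nat}.
Implicit Types (B : set 'rV[K]_n) (g h : 'rV[K]_n -> K) (A C : K).

(** The innermost derivative comes first, so that the derivatives of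
    'D_(delta_mx 0 i) g are literally among those of g. *)
Fixpoint partial (s : seq 'I_n) g : 'rV[K]_n -> K :=
  if s is i :: s' then partial s' ('D_(delta_mx 0 i) g) else g.

(** C A^b rising(m, b) is the b-th derivative at 0 of C (1 - A t)^(-m), the
    majorant of g. *)
Definition majorized_on B A m C g :=
  [/\ smooth_on B g, 0 <= C & forall s y, B y ->
    `|partial s g y| <= C * A ^+ size s * (rising m (size s))%:R].

Lemma partial_eq B g h s : open B -> (forall y, B y -> g y = h y) ->
  forall y, B y -> partial s g y = partial s h y.
Proof.
move=> oB; elim: s g h => [|i s IH] g h gh //=.
by apply: IH => y By; apply: near_eq_derive; exact: near_open_eq gh.
Qed.

Lemma partialD B g h s : open B -> smooth_on B g -> smooth_on B h ->
  forall y, B y -> partial s (g + h) y = partial s g y + partial s h y.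
Proof.
move=> oB; elim: s g h => [|i s IH] g h sg sh y By //=.
rewrite -IH //; [|exact: smooth_on_derive..].
apply: (partial_eq _ oB) By => z Bz.
rewrite deriveD //; exact: smooth_on_derivable Bz.
Qed.

Lemma partial_cst B c i s : open B ->
  forall y, B y -> partial (i :: s) (cst c) y = 0.
Proof.
move=> oB; elim: s c i => [|j s IH] c i y By; first by rewrite /= derive_cst.
rewrite -(IH 0 j y By) /=; apply: (partial_eq _ oB) By => z Bz.
apply: near_eq_derive; apply: (near_open_eq oB Bz) => w _.
by rewrite derive_cst.
Qed.

Section FixedBall.
Variables (B : set 'rV[K]_n) (A : K).
Hypotheses (oB : open B) (A0 : 0 <= A).

Lemma majorized_eq m C g h : (forall y, B y -> g y = h y) ->
  majorized_on B A m C g -> majorized_on B A m C h.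
Proof.
move=> gh [sg C0 bg]; split=> // [|s y By]; first exact: smooth_on_eq gh sg.
by rewrite -(partial_eq s oB gh By) bg.
Qed.

Lemma majorized_bound m C g y : majorized_on B A m C g -> B y -> `|g y| <= C.
Proof. by move=> [_ _ /(_ [::] y)] + By => /(_ By); rewrite /= !mulr1. Qed.

Lemma majorized_le m m' C C' g : (m <= m')%N -> C <= C' ->
  majorized_on B A m C g -> majorized_on B A m' C' g.
Proof.
move=> mm' CC' [sg C0 bg]; split=> // [|s y By]; first exact: le_trans CC'.
apply: le_trans (bg s y By) _; apply: ler_pM => //.
- by rewrite mulr_ge0 ?exprn_ge0.
- by rewrite ler_wpM2r ?exprn_ge0.
- by rewrite ler_nat leq_rising.
Qed.

(** The derivative of (1 - A t)^(-m) is m A (1 - A t)^(-m-1). *)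
Lemma majorized_derive m C g i : majorized_on B A m C g ->
  majorized_on B A m.+1 (C * A * m%:R) ('D_(delta_mx 0 i) g).
Proof.
move=> [sg C0 bg]; split=> [||s y By]; first exact: smooth_on_derive.
  by rewrite !mulr_ge0.
apply: le_trans (bg (i :: s) y By) _; rewrite /= exprS natrM.
by rewrite !mulrA [_ * A ^+ _ * m%:R]mulrAC.
Qed.

Lemma majorized_add m C C' g h : majorized_on B A m C g -> majorized_on B A m
  C' h ->
  majorized_on B A m (C + C') (g + h).
Proof.
move=> [sg C0 bg] [sh C'0 bh]; split=> [||s y By]; first exact: smooth_on_add.
  exact: addr_ge0.
rewrite (partialD s oB) // !mulrDl; apply: le_trans (ler_normD _ _) _.
by rewrite lerD ?bg ?bh.
Qed.

Lemma majorized_cst m c : majorized_on B A m `|c| (cst c).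
Proof.
split=> [||[|i s] y By] //; first exact: smooth_on_cst.
  by rewrite /= !mulr1.
by rewrite (partial_cst _ _ _ oB By) normr0 !mulr_ge0 ?exprn_ge0.
Qed.

Lemma majorized_sum (I : Type) (r : seq I) m (C : I -> K) (g : I -> 'rV[K]_n ->
  K) :
  (forall i, majorized_on B A m (C i) (g i)) ->
  majorized_on B A m (\sum_(i <- r) C i) (\sum_(i <- r) g i).
Proof.
move=> bg; elim/big_ind2: _ => //;
  first by rewrite -[X in majorized_on _ _ _ X _](@normr0 _ K);
    exact: majorized_cst.
by move=> ? ? ? ?; exact: majorized_add.
Qed.

(** The majorants multiply.  By induction on the number of derivatives, the
    Leibniz rule needs only m rising(m + m' + 1, b) + m' rising(m + m' + 1, b)
    = rising(m + m', b + 1), and no binomial sum. *)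
Lemma majorized_mul m m' C C' g h : majorized_on B A m C g -> majorized_on B A
  m' C' h ->
  majorized_on B A (m + m') (C * C') (g * h).
Proof.
move=> bg bh; have [sg C0 _] := bg; have [sh C'0 _] := bh.
split=> [||s]; [exact: smooth_on_mul|exact: mulr_ge0|].
elim: s m m' C C' g h bg bh {sg C0 sh C'0} => [|i s IH] m m' C C' g h bg bh y By.
  rewrite /= !mulr1 normrM.
  by rewrite ler_pM // ?(majorized_bound bg) ?(majorized_bound bh).
have [sg _ _] := bg; have [sh _ _] := bh.
have bg' := majorized_derive i bg; have bh' := majorized_derive i bh.
have [sg' _ _] := bg'; have [sh' _ _] := bh'.
have -> : partial (i :: s) (g * h) y =
    partial s ('D_(delta_mx 0 i) g * h) y + partial s (g * 'D_(delta_mx 0 i) h) y.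
  rewrite -(partialD s oB) //; [|exact: smooth_on_mul..].
  rewrite [LHS]/=; apply: (partial_eq _ oB) By => z Bz.
  rewrite deriveM; [|exact: smooth_on_derivable Bz..].
  by rewrite addrC [_ *: 'D_ _ g z]mulrC.
apply: le_trans (ler_normD _ _) _.
apply: le_trans (lerD (IH _ _ _ _ _ _ bg' bh y By) (IH _ _ _ _ _ _ bg bh' y
  By)) _.
rewrite /= exprS addnS addSn natrM natrD le_eqVlt; apply/orP; left; apply/eqP.
by ring.
Qed.

Lemma majorized_prod (I : Type) (r : seq I) (m : I -> nat) (C : I -> K)
    (g : I -> 'rV[K]_n -> K) :
  (forall i, majorized_on B A (m i) (C i) (g i)) ->
  majorized_on B A (\sum_(i <- r) m i) (\prod_(i <- r) C i) (\prod_(i <- r) g i).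
Proof.
move=> bg; elim: r => [|i r IH]; last by rewrite !big_cons; exact: majorized_mul.
by rewrite !big_nil -[X in majorized_on _ _ _ X _](@normr1 K);
  exact: majorized_cst.
Qed.

Lemma majorized_exp m C g k : majorized_on B A m C g ->
  majorized_on B A (k * m) (C ^+ k) (g ^+ k).
Proof.
move=> bg; elim: k => [|k IH].
  by rewrite !expr0 -[X in majorized_on _ _ _ X _](@normr1 K);
    exact: majorized_cst.
by rewrite !exprS mulSn; exact: majorized_mul.
Qed.

End FixedBall.
End Majorants.

Section MajorantCalculus.
Context {K : numFieldType} {n : nat}.
Implicit Types (B : set 'rV[K]_n) (g h : 'rV[K]_n -> K) (A C : K).
Implicit Types f : 'rV[K]_n -> 'rV[K]_n.

Lemma entry_norm_le (y : 'rV[K]_n) i : `|y 0 i| <= `|y|.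
Proof.
rewrite [X in _ <= X]/Num.norm /= mx_normE.
set b := (\big[_/_]_(_ <- _) _); have : (b <= b)%O by [].
by rewrite {1}/b => /bigmax_leP[_ /(_ (0, i) isT)]; rewrite -num_le.
Qed.

(** The exponent m can be traded for a larger A: the degree of a polynomial or
    monomial disappears into the constant as a factor 2^m. *)
Lemma majorized_renorm B A m C g : open B -> 0 <= A ->
  majorized_on B A m C g -> majorized_on B (A *+ 2) 1 (C * 2 ^+ m) g.
Proof.
move=> oB A0 [sg C0 bg]; split=> // [|s y By].
  by rewrite mulr_ge0 // exprn_ge0.
apply: le_trans (bg s y By) _; rewrite rising1.
have : (rising m (size s))%:R <= (2 ^ (m + size s) * (size s)`!)%:R :> K.
  by rewrite ler_nat rising_bound.
move=> /(ler_wpM2l (mulr_ge0 C0 (exprn_ge0 (size s) A0))) /le_trans; apply.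
rewrite natrM natrX exprD -[A *+ 2]mulr_natr exprMn le_eqVlt.
by apply/orP; left; apply/eqP; ring.
Qed.

Lemma derive_coordB (a : K) (y v : 'rV[K]_n) i :
  'D_v (fun z : 'rV[K]_n => z 0 i - a) y = v 0 i.
Proof.
rewrite -[X in derive X _ _]/((fun y : 'rV[K]_n => y 0 i) - cst a).
rewrite deriveB //; last exact: diff_derivable (differentiable_coord _ _ _).
rewrite derive_cst subr0.
have := @derive_coord K n (@id 'rV[K]_n) y v i.
rewrite derive_id; apply; exact: ex_diff.
Qed.

Lemma majorized_coord B A C a i : open B -> 0 <= A -> 1 <= C * A ->
  (forall y, B y -> `|y 0 i - a| <= C) -> 0 <= C ->
  majorized_on B A 1 C (fun y => y 0 i - a).
Proof.
move=> oB A0 CA yC C0; split=> //.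
  rewrite -[X in smooth_on _ X]/((fun y : 'rV[K]_n => y 0 i) + cst (- a)).
  by apply: smooth_on_add => //;
    [exact: smooth_on_coord (smooth_on_id oB)|exact: smooth_on_cst].
move=> [|j s] y By; first by rewrite /= !mulr1 yC.
have E z : B z -> 'D_(delta_mx 0 j) (fun y : 'rV[K]_n => y 0 i - a) z = cst (i
  == j)%:R z.
  by move=> _; rewrite derive_coordB mxE eqxx.
rewrite /= (partial_eq s oB E By); case: s => [|l s]; last first.
  rewrite (partial_cst _ _ _ oB By) normr0; apply: mulr_ge0 => //.
  by apply: mulr_ge0 => //; exact: exprn_ge0.
rewrite /= expr1 mulr1 normr_nat; apply: le_trans CA.
by case: (i == j).
Qed.

Lemma majorized_sub B B' A m C g : B' `<=` B -> majorized_on B A m C g ->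
  majorized_on B' A m C g.
Proof.
move=> B'B [sg C0 bg]; split=> //; first exact: smooth_on_sub sg.
by move=> s y /B'B; exact: bg.
Qed.

Lemma majorized_leA B A A' m C g : 0 <= A -> A <= A' -> majorized_on B A m C g ->
  majorized_on B A' m C g.
Proof.
move=> A0 AA' [sg C0 bg]; split=> // s y By; apply: le_trans (bg s y By) _.
by rewrite ler_wpM2r // ler_wpM2l // lerXn2r // nnegrE (le_trans A0).
Qed.

(** The constant (2 C)^|alpha| is a power, with C the radius of the domain: this
    is what makes the partial sums of a power series uniformly majorized on a
    polydisc of half its radius of absolute convergence. *)
Lemma majorized_monomial B A C a (al : 'I_n -> nat) : open B -> 0 <= A -> 1 <=
  C * A ->
  (forall i y, B y -> `|y 0 i - a i| <= C) -> 0 <= C ->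
  majorized_on B (A *+ 2) 1 ((C *+ 2) ^+ (\sum_(i < n) al i))
    (fun y : 'rV[K]_n => \prod_(i < n) (y 0 i - a i) ^+ al i).
Proof.
move=> oB A0 CA yC C0.
have H i := majorized_exp oB A0 (al i) (majorized_coord oB A0 CA (yC i) C0).
have := majorized_renorm oB A0 (majorized_prod oB A0 (index_enum 'I_n) H).
have -> : (\prod_(i < n) C ^+ al i) * 2 ^+ (\sum_(i < n) (al i * 1))%N =
          (C *+ 2) ^+ (\sum_(i < n) al i)%N.
  rewrite prodrXr -[C *+ 2]mulr_natr exprMn; congr (_ * _ ^+ _).
  by apply: eq_bigr => i _; rewrite muln1.
apply: majorized_eq => // y _.
by rewrite fct_prodE; apply: eq_bigr => i _; rewrite exprfctE.
Qed.

(** One factor 1 - A t in the denominator comes from f, one from the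
    derivative of g. *)
Lemma majorized_lie_derivative B A m M C f g : open B -> 0 <= A ->
  (forall i, majorized_on B A 1 M (fun y => f y 0 i)) -> majorized_on B A m C g ->
  majorized_on B A m.+2 (n%:R * M * A * C * m%:R) (lie_derivative f g).
Proof.
move=> oB A0 fM gC; have [sg _ _] := gC.
pose Xg := \sum_(i < n) (fun y => f y 0 i) * 'D_(delta_mx 0 i) g.
have : majorized_on B A (1 + m.+1) (\sum_(i < n) M * (C * A * m%:R)) Xg.
  apply: majorized_sum => // i; apply: majorized_mul => //;
    exact: majorized_derive.
rewrite sumr_const card_ord -[_ *+ n]mulr_natl.
have -> : n%:R * (M * (C * A * m%:R)) = n%:R * M * A * C * m%:R by ring.
apply: majorized_eq => // y By.
by rewrite (lie_derivativeE _ sg By) /Xg fct_sumE.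
Qed.

(** The exponents are 1, 3, 5, ...; the product of the factors 2 j + 1 that
    they contribute is at most 2^k k!. *)
Lemma majorized_iter_lie B A M C f g k : open B -> 0 <= A -> 0 <= M ->
  (forall i, majorized_on B A 1 M (fun y => f y 0 i)) -> majorized_on B A 1 C g ->
  majorized_on B A k.*2.+1 (C * (n%:R * M * A *+ 2) ^+ k * k`!%:R)
    (iter k (lie_derivative f) g).
Proof.
move=> oB A0 M0 fM gC; have [_ C0 _] := gC; elim: k => [|k IH].
  by rewrite expr0 !mulr1.
have := majorized_lie_derivative oB A0 fM IH.
apply: majorized_le => //; set L := n%:R * M * A.
have L0 : 0 <= L by rewrite !mulr_ge0.
have -> : L * (C * (L *+ 2) ^+ k * k`!%:R) * (k.*2.+1)%:R =
    C * (L *+ 2) ^+ k * k`!%:R * L * (k.*2.+1)%:R by ring.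
have -> : C * (L *+ 2) ^+ k.+1 * (k.+1)`!%:R =
    C * (L *+ 2) ^+ k * k`!%:R * L * (k.+1.*2)%:R.
  by rewrite factS natrM -muln2 natrM exprS -[L *+ 2]mulr_natr; ring.
by rewrite ler_wpM2l ?ler_nat // !mulr_ge0 // exprn_ge0 // mulrn_wge0.
Qed.

End MajorantCalculus.

(** * Scalars and the mean value inequality *)

Section RealPart.
Context {R : realType} {k : scalar_kind}.
Local Notation K := (scalars R k).
Implicit Types (z w : K) (r : R).

Definition of_real : {rmorphism R -> K} :=
  match k return {rmorphism R -> scalars R k} with
  | RealScalars => idfun
  | ComplexScalars => real_complex R
  end.

Definition re_part : K -> R :=
  match k return scalars R k -> R with
  | RealScalars => id
  | ComplexScalars => @complex.Re R
  end.

Definition im_part : K -> R :=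
  match k return scalars R k -> R with
  | RealScalars => cst 0
  | ComplexScalars => @complex.Im R
  end.

(** Zero for real scalars, so that the decomposition of a scalar into real and
    imaginary parts has the same form for both kinds. *)
Definition imag_unit : K :=
  match k return scalars R k with
  | RealScalars => 0
  | ComplexScalars => 'i%C
  end.
End RealPart.
Arguments of_real {R} k.

Section RealPartTheory.
Context {R : realType} {k : scalar_kind}.
Local Notation K := (scalars R k).
Implicit Types (z w : K) (r : R).

Lemma ler_of_real r s : (of_real k r <= of_real k s) = (r <= s).
Proof. by case: k => //=; rewrite lecR. Qed.

Lemma ltr_of_real r s : (of_real k r < of_real k s) = (r < s).
Proof. by case: k => //=; rewrite ltcR. Qed.

Lemma of_real_ge0 r : (0 <= of_real k r) = (0 <= r).
Proof. by rewrite -{1}(rmorph0 (of_real k)) ler_of_real. Qed.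

Lemma of_real_gt0 r : (0 < of_real k r) = (0 < r).
Proof. by rewrite -{1}(rmorph0 (of_real k)) ltr_of_real. Qed.

Lemma re_partD z w : re_part (z + w) = re_part z + re_part w.
Proof. by case: k z w => //= -[? ?] [? ?]. Qed.

Lemma im_partD z w : im_part (z + w) = im_part z + im_part w.
Proof. by case: k z w => //= [? ?|[? ?] [? ?]//]; rewrite addr0. Qed.

Lemma re_partZ r z : re_part (of_real k r * z) = r * re_part z.
Proof. by case: k z => //= -[a b] /=; rewrite mul0r subr0. Qed.

Lemma re_partN z : re_part (- z) = - re_part z.
Proof. by case: k z => //= -[a b]. Qed.

Lemma re_part_norm z : of_real k `|re_part z| <= `|z|.
Proof. by case: k z => //= z; exact: normc_ge_Re. Qed.

Lemma im_part_norm z : of_real k `|im_part z| <= `|z|.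
Proof.
case: k z => [z|z] /=; first by rewrite normr0.
rewrite normc_def lecR -sqrtr_sqr ler_wsqrtr // lerDr sqr_ge0 //.
Qed.

Lemma scalarE z : z = of_real k (re_part z) + imag_unit * of_real k (im_part z).
Proof. by case: k z => [z|z] /=; [rewrite mul0r addr0|exact: complexE]. Qed.

Lemma real_of_real z : z \is Num.real -> z = of_real k (re_part z).
Proof. by case: k z => //= z zr; rewrite RRe_real. Qed.

Lemma ge0_of_real z : 0 <= z -> z = of_real k (re_part z).
Proof. by move=> z0; apply: real_of_real; exact: ger0_real. Qed.

Lemma of_real_real r : of_real k r \is Num.real.
Proof. by case: k => /=; [exact: num_real|rewrite complex_real]. Qed.

Lemma normr_of_real r : `|of_real k r| = of_real k `|r|.
Proof. by case: k => //=; rewrite normc_def /= expr0n addr0 sqrtr_sqr. Qed.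

Lemma norm_segment_le (r : R) z : 0 <= r <= 1 -> `|of_real k r * z| <= `|z|.
Proof.
move=> /andP[r0 r1]; rewrite normrM normr_of_real (ger0_norm r0).
by apply: ler_piMl => //; rewrite -(rmorph1 (of_real k)) ler_of_real.
Qed.

Lemma re_part_norm_ge0 z : 0 <= z -> 0 <= re_part z.
Proof. by move=> z0; rewrite -of_real_ge0 -ge0_of_real. Qed.

Lemma scalar_archi z : exists m : nat, `|z| <= m%:R.
Proof.
exists (Num.truncn (re_part `|z|)).+1.
rewrite [leLHS](ge0_of_real (normr_ge0 z)) -(rmorph_nat (of_real k))
  ler_of_real ltW //.
exact: real_truncnS_gt (num_real _).
Qed.

Lemma of_real_continuous : continuous (of_real k : R -> K).
Proof.
move=> r; apply/cvgrPdist_lt => e e0.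
have er : 0 < re_part e by rewrite -of_real_gt0 -ge0_of_real // ltW.
have : nbhs r (ball r (re_part e)) by exact: nbhsx_ballx.
apply: filterS => t /= rt.
by rewrite -rmorphB normr_of_real (ge0_of_real (ltW e0)) ltr_of_real.
Qed.

End RealPartTheory.

Definition derivative_along {K : numFieldType} {V : normedModType K} (T : set K)
    (x : K -> V) (t : K) (v : V) :=
  (fun h : K => h^-1 *: (x (t + h) - x t)) @ within T 0^' --> v.

(** Multiplying out the difference quotient includes the increment h = 0, which
    makes the estimate stable under composition. *)
Lemma derivative_alongP {K : numFieldType} {V : normedModType K} (T : set K)
    (x : K -> V) (t : K) (v : V) :
  derivative_along T x t v <->
  forall e, 0 < e -> exists2 r, 0 < r & forall h, T h -> `|h| < r ->
    `|x (t + h) - x t - h *: v| <= e * `|h|.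
Proof.
have D h : h != 0 -> h^-1 *: (x (t + h) - x t) - v =
    h^-1 *: (x (t + h) - x t - h *: v).
  by move=> h0; rewrite [RHS]scalerBr scalerA mulVf // scale1r.
split=> [xv e e0|xv].
  have := (cvgrPdist_le (FF := within_filter T _) _ _).1 xv _ e0.
  move=> H; have {H} : \forall h \near (0 : K), h != 0 -> T h ->
      `|v - h^-1 *: (x (t + h) - x t)| <= e by exact: H.
  move=> /(nbhs_ballP (0 : K)) [r /= r0 rP]; exists r => // h Th hr.
  have [->|h0] := eqVneq h 0;
    first by rewrite addr0 subrr scale0r subr0 !normr0 mulr0.
  have := rP h; rewrite /ball /= sub0r normrN => /(_ hr h0 Th).
  by rewrite distrC D // normrZ normfV ler_pdivrMl ?normr_gt0 // mulrC.
apply/(cvgrPdist_le (FF := within_filter T _)) => e e0.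
suff : \forall h \near (0 : K), h != 0 -> T h ->
    `|v - h^-1 *: (x (t + h) - x t)| <= e by [].
have [r r0 rP] := xv _ e0; apply/(nbhs_ballP (0 : K)); exists r => //= h.
rewrite /ball /= sub0r normrN => hr h0 Th.
by rewrite distrC D // normrZ normfV ler_pdivrMl ?normr_gt0 // mulrC rP.
Qed.

Lemma is_derive_real {R : realType} (p : R -> R) s l :
  (forall e, 0 < e -> exists2 r, 0 < r & forall h, `|h| < r ->
    `|p (s + h) - p s - h * l| <= e * `|h|) -> is_derive s 1 p l.
Proof.
move=> pl.
have H : (fun h => h^-1 *: (p (h *: 1 + s) - p s)) @ 0^' --> l.
  have -> : (fun h => h^-1 *: (p (h *: 1 + s) - p s)) =
      (fun h => h^-1 *: (p (s + h) - p s)).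
    by apply/funext => h; rewrite [_ + s]addrC [h *: 1]mulr1.
  have : derivative_along setT p s l.
    by apply/derivative_alongP => e /pl[r r0 rP]; exists r => // h _; exact: rP.
  by rewrite /derivative_along withinET.
by apply: DeriveDef; [apply/cvg_ex; exists l | exact: cvg_lim H].
Qed.

Section TimeAxis.
Context {R : realType} {k : scalar_kind}.
Local Notation K := (scalars R k).
Variable T : set K.
Hypothesis tT : time_axis T.

Lemma time_axis_of_real r : T (of_real k r).
Proof. by case: tT => -> //=; exact: of_real_real. Qed.

Lemma time_axisB s t : T s -> T t -> T (s - t).
Proof. by case: tT => -> //=; exact: realB. Qed.

Lemma time_axisD s t : T s -> T t -> T (s + t).
Proof. by case: tT => -> //=; exact: realD. Qed.

Lemma time_axisZ r t : T t -> T (of_real k r * t).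
Proof. by case: tT => -> //=; apply: realM; exact: of_real_real. Qed.

(** Taking the real part of a multiple of u along a segment of the time axis
    gives a real function of a real variable, to which the mean value theorem
    applies. *)
Lemma derivative_along_path (u : K -> K) (t d c w : K) (s : R) : d != 0 -> T d ->
  derivative_along T u (t + of_real k s * d) w ->
  is_derive s 1 (fun s' => re_part (c * u (t + of_real k s' * d)))
    (re_part (c * (d * w))).
Proof.
move=> d0 Td /derivative_alongP uw; apply: is_derive_real => e e0.
pose M := `|c| * `|d| + 1.
have M0 : 0 < M by rewrite ltr_wpDl // mulr_ge0.
have e'0 : 0 < of_real k e / M by rewrite divr_gt0 // of_real_gt0.
have dn0 : 0 < `|d| by rewrite normr_gt0.
have [r r0 rP] := uw _ e'0.
have rE : of_real k (re_part (r / `|d|)) = r / `|d|.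
  by rewrite -ge0_of_real // divr_ge0 // ltW.
exists (re_part (r / `|d|)); first by rewrite -(of_real_gt0 (k := k)) rE divr_gt0.
move=> h hr; have {rP} := rP (of_real k h * d) (time_axisZ h Td).
rewrite normrM normr_of_real -ltr_pdivlMr // -rE ltr_of_real => /(_ hr) rP.
rewrite rmorphD mulrDl addrA -!re_partN -re_partZ -re_partN -!re_partD.
rewrite -(ler_of_real (k := k)); apply: le_trans (re_part_norm _) _.
set t' := t + _.
have -> : c * u (t' + of_real k h * d) - c * u t' - of_real k h * (c * (d * w)) =
    c * (u (t' + of_real k h * d) - u t' - (of_real k h * d) *: w).
  by rewrite /GRing.scale /= !mulrBr; congr (_ - _); ring.
rewrite normrM; apply: le_trans (ler_wpM2l (normr_ge0 c) rP) _.
rewrite rmorphM /=.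
have -> : `|c| * (of_real k e / M * (of_real k `|h| * `|d|)) =
   of_real k e * of_real k `|h| * ((`|c| * `|d|) / M) by ring.
apply: ler_piMr; first by rewrite mulr_ge0 // of_real_ge0 // ltW.
by rewrite ler_pdivrMr // mul1r /M lerDl.
Qed.

(** The unit scalar c rotates u t - u t0 onto the positive real axis, so that
    the real part of c u grows by exactly the norm of the increment of u. *)
Lemma path_increment_le (u v : K -> K) (t0 t : K) (Q : {poly R}) :
  T t0 -> T t ->
  (forall s : R, 0 <= s <= 1 ->
     let tau := t0 + of_real k s * (t - t0) in
     derivative_along T u tau (v tau) /\
     `|(t - t0) * v tau| <= of_real k Q^`().[s]) ->
  `|u t - u t0| <= of_real k (Q.[1] - Q.[0]).
Proof.
move=> Tt0 Tt; set d := t - t0 => uv.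
have Q'0 s : 0 <= s <= 1 -> 0 <= Q^`().[s].
  by move=> s01; rewrite -(of_real_ge0 (k:=k)); apply: le_trans (uv s s01).2.
have Td : T d by exact: time_axisB.
have Q01 : 0 <= Q.[1] - Q.[0].
  have [c c01 ->] := @MVT_segment R (horner Q) (horner Q^`()) 0 1 ler01
    (fun x _ => is_derive_poly Q x) (continuous_subspaceT (@continuous_horner _
      Q)).
  by rewrite subr0 mulr1 Q'0.
have [d0|d0] := eqVneq d 0.
  by move/eqP : d0; rewrite subr_eq0 => /eqP ->; rewrite subrr normr0 of_real_ge0.
pose z := u t - u t0.
have [z0|z0] := eqVneq z 0; first by rewrite -/z z0 normr0 of_real_ge0.
pose c := `|z| / z.
have c1 : `|c| = 1 by rewrite normrM normfV normr_id mulfV // normr_eq0.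
pose p s := re_part (c * u (t0 + of_real k s * d)).
have p' (s : R) : 0 <= s <= 1 ->
    is_derive s 1 p (re_part (c * (d * v (t0 + of_real k s * d)))).
  by move=> s01; apply: derivative_along_path => //; exact: (uv s s01).1.
have f' (s : R) : 0 <= s <= 1 -> is_derive s 1 (p - horner Q)
    (re_part (c * (d * v (t0 + of_real k s * d))) - Q^`().[s]).
  by move=> /p' ?; exact: is_deriveB.
have fo (x : R) : x \in `]0, 1[ -> is_derive x 1 (p - horner Q)
    (re_part (c * (d * v (t0 + of_real k x * d))) - Q^`().[x]).
  by rewrite in_itv /= => /andP[x0 x1]; apply: f'; rewrite !ltW.
have fc : {within `[0, 1], continuous (p - horner Q)}.
  by apply: derivable_within_continuous => x; rewrite in_itv /= => /f'.
have [s] := MVT_segment ler01 fo fc.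
rewrite in_itv /= => s01; rewrite subr0 mulr1 => E.
have : (p - horner Q) 1 - (p - horner Q) 0 <= 0.
  rewrite E subr_le0; have [_] := uv s s01.
  rewrite -(ler_of_real (k := k)); apply: le_trans.
  rewrite -[leRHS]mul1r -c1 -normrM; apply: le_trans (re_part_norm _).
  by rewrite ler_of_real ler_norm.
rewrite [(p - _) 1]/(p 1 - Q.[1]) [(p - _) 0]/(p 0 - Q.[0]) => H.
rewrite -/z (ge0_of_real (normr_ge0 z)) ler_of_real.
have <- : p 1 - p 0 = re_part `|z|.
  rewrite /p rmorph1 rmorph0 mul1r mul0r addr0 /d [t0 + _]addrC subrK.
  by rewrite -re_partN -re_partD -mulrBr -/z /c divfK.
rewrite -subr_le0; suff -> : p 1 - p 0 - (Q.[1] - Q.[0]) =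
  p 1 - Q.[1] - (p 0 - Q.[0]) by []; ring.
Qed.

(** The comparison function is the polynomial sum_j b_j r^(j+1) / (j+1) in the
    distance r to t0; polynomial bounds are kept by integration, which is the
    form in which the inequality is iterated to give Taylor estimates. *)
Lemma increment_le (u v : K -> K) (t0 t : K) (b : nat -> K) N :
  T t0 -> T t -> (forall j, 0 <= b j) ->
  (forall s : R, 0 <= s <= 1 ->
     let tau := t0 + of_real k s * (t - t0) in
     derivative_along T u tau (v tau) /\
     `|v tau| <= \sum_(j < N) b j * `|tau - t0| ^+ j) ->
  `|u t - u t0| <= \sum_(j < N) b j * `|t - t0| ^+ j.+1 / j.+1%:R.
Proof.
move=> Tt0 Tt b0 uv.
(* The parameter s runs through [0, 1], so the powers of |t - t0| enter the
coefficients. *)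
pose be j := re_part (b j * `|t - t0| ^+ j.+1).
have beE j : of_real k (be j) = b j * `|t - t0| ^+ j.+1.
  by rewrite -ge0_of_real // mulr_ge0 // exprn_ge0.
pose Q : {poly R} := \sum_(j < N) (be j / j.+1%:R) *: 'X^(j.+1).
have := @path_increment_le u v t0 t Q Tt0 Tt.
have -> : of_real k (Q.[1] - Q.[0]) = \sum_(j < N) b j * `|t - t0| ^+ j.+1 /
  j.+1%:R.
  rewrite /Q !horner_sum -sumrB rmorph_sum; apply: eq_bigr => j _.
  rewrite !hornerE expr1n expr0n /= mulr1 mulr0 subr0.
  by rewrite fmorph_div /= beE rmorph_nat.
apply=> s s01 tau; have [uD vb] := uv s s01; split=> //.
rewrite normrM; apply: le_trans (ler_wpM2l (normr_ge0 _) vb) _.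
rewrite /Q (raddf_sum (@deriv R)) horner_sum rmorph_sum mulr_sumr ler_sum // =>
  j _ /=.
rewrite derivZ derivXn hornerZ hornerMn hornerXn !rmorphM fmorphV rmorphMn.
rewrite /= beE rmorph1 rmorphMn rmorphXn /tau addrAC subrr add0r normrM
  normr_of_real.
have /andP[s0 _] := s01; rewrite (ger0_norm s0) exprMn exprS.
rewrite -[X in _ <= _ * X]mulr_natr [X in _ <= _ * X]mulrC.
rewrite [X in _ <= X]mulrA divfK ?pnatr_eq0 //.
by rewrite [X in X <= _]mulrCA (mulrCA `|_|) (mulrC (_ ^+ j)) mulrA mulrA.
Qed.

End TimeAxis.

(** * Limits of functions with bounded derivatives *)

Section DerivativeAlong.
Context {K : numFieldType} (T : set K).

Lemma derivative_alongB (V : normedModType K) (x x' : K -> V) t v v' :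
  derivative_along T x t v -> derivative_along T x' t v' ->
  derivative_along T (fun s => x s - x' s) t (v - v').
Proof.
move=> dx dx'; rewrite /derivative_along.
have -> : (fun h => h^-1 *: (x (t + h) - x' (t + h) - (x t - x' t))) =
    (fun h => h^-1 *: (x (t + h) - x t)) - (fun h => h^-1 *: (x' (t + h) - x' t)).
  by apply/funext => h;
    rewrite !fctE -scalerBr !opprB addrACA [- x' _ + _]addrC addrACA.
exact: (@cvgB _ _ _ _ (within_filter _ _)).
Qed.

Lemma derivative_along_eq (V : normedModType K) (x : K -> V) t v w :
  v = w -> derivative_along T x t v -> derivative_along T x t w.
Proof. by move=> ->. Qed.

Lemma derivative_along_linear (c t : K) :
  derivative_along T (fun s => s * c) t c.
Proof.
apply/derivative_alongP => e e0; exists 1 => // h _ _.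
rewrite mulrDl [t * c + _]addrC addrK [h *: c]/(h * c) subrr normr0.
by rewrite mulr_ge0 // ltW.
Qed.

End DerivativeAlong.

Lemma sub_linear_part (V : zmodType) (a b p q : V) :
  a - (p + q) - (b - p) = a - b - q.
Proof. by rewrite opprB addrA [_ + p]addrAC opprD addrA addrK addrAC. Qed.

Section LimitsOfMajorizedFunctions.
Context {R : realType} {k : scalar_kind} {n : nat}.
Local Notation K := (scalars R k).
Implicit Types (B U : set 'rV[K]_n) (g : 'rV[K]_n -> K) (y v : 'rV[K]_n).

Lemma time_axisT : time_axis [set: K].
Proof. by right. Qed.

Lemma derivable_along g y v (tau : K) : derivable g (y + tau *: v) v ->
  derivative_along setT (fun s => g (y + s *: v)) tau ('D_v g (y + tau *: v)).
Proof.
move=> dg; rewrite /derivative_along withinET.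
have -> : (fun h => h^-1 *: (g (y + (tau + h) *: v) - g (y + tau *: v))) =
  (fun h => h^-1 *: (g (h *: v + (y + tau *: v)) - g (y + tau *: v))).
  by apply/funext => h; rewrite scalerDl [tau *: v + _]addrC addrCA.
exact: dg.
Qed.

(** Two mean value inequalities: v varies by at most C |h|, hence so does the
    derivative of u s - s v(t). *)
Lemma second_order_along (u v w : K -> K) (t h C : K) :
  (forall s : R, 0 <= s <= 1 ->
    let tau := t + of_real k s * h in
    [/\ derivative_along setT u tau (v tau), derivative_along setT v tau (w tau) &
        `|w tau| <= C]) ->
  0 <= C -> `|u (t + h) - u t - h * v t| <= C * `|h| ^+ 2.
Proof.
move=> uvw C0.
have step s tau : 0 <= s <= 1 -> tau = t + of_real k s * h ->
    `|v tau - v t| <= C * `|tau - t|.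
  move=> s01 tauE.
  have := @increment_le R k setT time_axisT v w t tau (fun=> C) 1 Logic.I
    Logic.I (fun=> C0).
  rewrite !big_ord1 expr1 divr1; apply=> s' s'01 /=.
  have E : t + of_real k s' * (tau - t) = t + of_real k (s' * s) * h.
    by rewrite tauE [t + _ - t]addrC addKr rmorphM mulrA.
  rewrite E big_ord1 expr0 mulr1.
  have [] // := uvw (s' * s); move: s01 s'01 => /andP[s0 s1] /andP[s'0 s'1].
  by rewrite mulr_ge0 // mulr_ile1.
have := @increment_le R k setT time_axisT (fun s => u s - s * v t)
  (fun s => v s - v t) t (t + h) (fun j => if j == 1%N then C else 0) 2 Logic.I
    Logic.I.
rewrite !big_ord_recl !big_ord0 /= [t + h - t]addrC addKr !mul0r add0r addr0
  mulrDl.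
rewrite sub_linear_part.
move=> H; apply: le_trans (H _ _) _.
- by move=> j; case: ifP.
- move=> s s01; rewrite !big_ord_recl !big_ord0 /bump /= !mul0r add0r addr0.
  have [uD _ _] := uvw s s01; split; last by rewrite expr1; exact: step s01 erefl.
  by apply: derivative_alongB uD _; exact: derivative_along_linear.
- by rewrite ler_pdivrMr // ler_peMr // ?ler1n // mulr_ge0 // exprn_ge0.
Qed.

Lemma second_order_le B g y v (C r h : K) :
  (forall tau : K, `|tau| < r -> B (y + tau *: v)) -> smooth_on B g ->
  (forall z, B z -> `|'D_v ('D_v g) z| <= C) -> 0 <= C -> `|h| < r ->
  `|g (y + h *: v) - g y - h * 'D_v g y| <= C * `|h| ^+ 2.
Proof.
move=> yB sg gC C0 hr.
have := @second_order_along (fun s => g (y + s *: v)) (fun s => 'D_v g (y + s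
  *: v))
  (fun s => 'D_v ('D_v g) (y + s *: v)) 0 h C.
rewrite add0r scale0r addr0; apply=> // s s01 tau.
have tauB : B (y + tau *: v).
  by apply: yB; apply: le_lt_trans hr; rewrite /tau add0r norm_segment_le.
split; last exact: gC.
  exact: derivable_along (smooth_on_derivable sg tauB).
exact: derivable_along (smooth_on_derivable (smooth_on_derive v sg) tauB).
Qed.

Lemma dnbhs0_ex (P : K -> Prop) : (\forall h \near 0^', P h) -> exists2 h, h !=
  0 & P h.
Proof.
move=> Pn; have [h [h0 Ph]] := @filter_ex _ _ (Proper_dnbhs_numFieldType _) _
  (filterI (nbhs_dnbhs_neq (0 : K)) Pn).
by exists h.
Qed.

Lemma difference_quotient_split (F : fieldType) (h a b g1 g0 G1 G0 : F) : h !=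
  0 ->
  a - b = (a - h^-1 * (g1 - g0)) + h^-1 * (g1 - G1) - h^-1 * (g0 - G0) +
    h^-1 * (G1 - G0 - h * b).
Proof. by move=> h0; field. Qed.

Lemma quarters (F : numFieldType) (e : F) : e = e / 4 + e / 4 + e / 4 + e / 4.
Proof. by field. Qed.

(** The difference quotient of step h differs from the derivative by at most
    C |h|, uniformly in N; for a fixed small h the quotients converge. *)
Lemma derive_cvg B (G : nat -> 'rV[K]_n -> K) g v y (C : K) :
  open B -> (forall N, smooth_on B (G N)) -> smooth_on B g ->
  0 <= C -> (forall N z, B z -> `|'D_v ('D_v (G N)) z| <= C) ->
  (forall z, B z -> G N z @[N --> \oo] --> g z) ->
  B y -> 'D_v (G N) y @[N --> \oo] --> 'D_v g y.
Proof.
move=> oB sG sg C0 GC Gg By.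
have /nbhs_ballP[r /= r0 rB] : nbhs y B by exact: open_nbhs_nbhs.
pose r' := r / (`|v| + 1).
have v1 : 0 < `|v| + 1 by rewrite ltr_wpDl.
have r'0 : 0 < r' by rewrite divr_gt0.
have yB (tau : K) : `|tau| < r' -> B (y + tau *: v).
  move=> taur; apply: rB;
    rewrite -ball_normE /= opprD addrA subrr add0r normrN normrZ.
  move: taur; rewrite ltr_pdivlMr //; apply: le_lt_trans.
  by rewrite ler_wpM2l // lerDl.
apply/cvgrPdist_le => e e0.
have e40 : 0 < e / 4 by rewrite divr_gt0.
have dg : derivable g y v by exact: smooth_on_derivable By.
have e4h : \forall h \near (0 : K)^', `|'D_v g y - h^-1 *: (g (h *: v + y) - g
  y)| <= e / 4.
  exact: (cvgrPdist_le _ _).1 dg _ e40.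
have C1 : 0 < C + 1 by rewrite ltr_wpDl.
have r1 : \forall h \near (0 : K)^', `|h| < r' by exact: (@dnbhs0_lt K K).
have r2 : \forall h \near (0 : K)^', `|h| < e / 4 / (C + 1).
  by apply: (@dnbhs0_lt K K); rewrite divr_gt0.
have [h h0 [[hg hr] hC]] := dnbhs0_ex (filterI (filterI e4h r1) r2).
have hn0 : 0 < `|h| by rewrite normr_gt0.
have eh0 : 0 < e / 4 * `|h| by rewrite mulr_gt0.
have n1 : \forall N \near \oo, `|g (y + h *: v) - G N (y + h *: v)| <= e / 4 *
  `|h|.
  exact: (cvgrPdist_le _ _).1 (Gg _ (yB h hr)) _ eh0.
have n2 : \forall N \near \oo, `|g y - G N y| <= e / 4 * `|h|.
  exact: (cvgrPdist_le _ _).1 (Gg _ By) _ eh0.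
apply: filterS (filterI n1 n2) => N [/= N1 N2].
have N3 := second_order_le yB (sG N) (GC N) C0 hr.
have -> : 'D_v g y - 'D_v (G N) y = ('D_v g y - h^-1 *: (g (h *: v + y) - g y)) +
   h^-1 * (g (y + h *: v) - G N (y + h *: v)) - h^-1 * (g y - G N y) +
   h^-1 * (G N (y + h *: v) - G N y - h * 'D_v (G N) y).
  by rewrite [h *: v + y]addrC [h^-1 *: _]/(h^-1 * _);
    exact: difference_quotient_split.
have bnd (z c : K) : `|z| <= c * `|h| -> `|h^-1 * z| <= c.
  by rewrite normrM normfV ler_pdivrMl // mulrC.
(* The derivative and the difference quotients of g and G N are compared in
four steps. *)
rewrite [leRHS](quarters e).
apply: le_trans (ler_normD _ _) _; apply: lerD; last first.
  apply: bnd; apply: le_trans N3 _; rewrite expr2 mulrA ler_wpM2r //.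
  move: hC; rewrite ltr_pdivlMr // => /ltW; apply: le_trans.
  by rewrite mulrC ler_wpM2l // lerDl.
apply: le_trans (ler_normB _ _) _; apply: lerD; last exact: bnd.
by apply: le_trans (ler_normD _ _) _; apply: lerD; last exact: bnd.
Qed.

Lemma le_of_le_eps (x c : K) : 0 <= c -> (forall e, 0 < e -> `|x| <= c + e) ->
  `|x| <= c.
Proof. by move=> c0 xc; apply/ler_addgt0Pr. Qed.

Lemma norm_limit_le (z : nat -> K) (z0 c : K) :
  z N @[N --> \oo] --> z0 -> (forall N, `|z N| <= c) -> `|z0| <= c.
Proof.
move=> zz0 zc; apply: le_of_le_eps; first exact: le_trans (normr_ge0 _) (zc 0%N).
move=> e e0; have : \forall N \near \oo, `|z0 - z N| <= e.
  exact: (cvgrPdist_le _ _).1 zz0 e e0.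
move=> [N _ /(_ N (leqnn N)) zN].
rewrite -(subrK (z N) z0) addrC; apply: le_trans (ler_normD _ _) _.
by apply: lerD.
Qed.

(** Only pointwise convergence is required: convergence of each derivative
    follows from the bound on the derivatives of the next order. *)
Lemma partial_limit_le B (G : nat -> 'rV[K]_n -> K) g (c : nat -> K) :
  open B -> (forall N, smooth_on B (G N)) -> smooth_on B g ->
  (forall N s y, B y -> `|partial s (G N) y| <= c (size s)) ->
  (forall y, B y -> G N y @[N --> \oo] --> g y) ->
  forall s y, B y -> `|partial s g y| <= c (size s).
Proof.
move=> oB sG sg Gc Gg s;
  elim: s G g c sG sg Gc Gg => [|i s IH] G g c sG sg Gc Gg y By.
  by apply: norm_limit_le (Gg y By) _ => N; exact: (Gc N [::] y By).
apply: (IH (fun N => 'D_(delta_mx 0 i) (G N)) _ (fun b => c b.+1)) => //.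
- by move=> N; exact: smooth_on_derive.
- exact: smooth_on_derive.
- by move=> N s' z Bz; exact: (Gc N (i :: s') z Bz).
- move=> z Bz; apply: (@derive_cvg B _ _ _ _ (c 2)) => //.
    exact: le_trans (normr_ge0 _) (Gc 0%N [:: i; i] z Bz).
  by move=> N w Bw; exact: (Gc N [:: i; i] w Bw).
Qed.

End LimitsOfMajorizedFunctions.

(** * Analytic and polynomial functions are majorized *)

Section LocalBounds.
Context {R : realType} {k : scalar_kind} {n : nat}.
Local Notation K := (scalars R k).
Implicit Types (B U : set 'rV[K]_n) (g : 'rV[K]_n -> K) (a y : 'rV[K]_n).
Implicit Types f : 'rV[K]_n -> 'rV[K]_n.

Definition majorized_at U a g :=
  exists B A C, [/\ open B, B a, B `<=` U, 0 <= A & majorized_on B A 1 C g].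

Lemma majorized_at_family U a (J : finType) (g : J -> 'rV[K]_n -> K) :
  open U -> U a -> (forall j, majorized_at U a (g j)) ->
  exists B A C, [/\ open B, B a, B `<=` U, (0 <= A) && (0 <= C) &
    forall j, majorized_on B A 1 C (g j)].
Proof.
move=> oU Ua gj.
suff [B [A [C [oB Ba BU AC H]]]] : exists B A C, [/\ open B, B a, B `<=` U,
    (0 <= A) && (0 <= C) & forall j, j \in enum J -> majorized_on B A 1 C (g j)].
  by exists B, A, C; split=> // j; apply: H; rewrite mem_enum.
elim: (enum J) => [|i s [B [A [C [oB Ba BU /andP[A0 C0] H]]]]].
  by exists U, 0, 0; split=> //; rewrite lexx.
have [B' [A' [C' [oB' B'a B'U A'0 H']]]] := gj i.
have [_ C'0 _] := H'.
exists (B `&` B'), (A + A'), (C + C'); split.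
- exact: openI.
- by [].
- by move=> y [/BU].
- by rewrite !addr_ge0.
move=> j; rewrite inE => /predU1P[->|js].
  apply: (@majorized_leA _ _ _ A') => //; first by rewrite lerDr.
  apply: (@majorized_le _ _ _ A' _ 1 1 C') => //; first by rewrite lerDr.
  by apply: (majorized_sub _ H') => y [].
apply: (@majorized_leA _ _ _ A) => //; first by rewrite lerDl.
apply: (@majorized_le _ _ _ A _ 1 1 C) => //; first by rewrite lerDl.
by apply: (majorized_sub _ (H j js)) => y [].
Qed.

(** On the polydisc of radius r / 2 a term of multi-index alpha is majorized with
    constant |c_alpha| r^|alpha|, and these are summable. *)
Lemma analytic_majorized U g a : open U -> U a -> smooth_on U g ->
  analytic_at g a -> majorized_at U a g.
Proof.
move=> oU Ua sg [c [r [M [r0 cM cg]]]].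
have M0 : 0 <= M.
  by apply: le_trans (cM 0%N); rewrite sumr_ge0 // => al _;
    rewrite mulr_ge0 // exprn_ge0 // ltW.
have r20 : 0 < r / 2 by rewrite divr_gt0.
pose B := U `&` ball a (r / 2).
have oB : open B by apply: openI => //; exact: ball_open.
have A0 : 0 <= (r / 2)^-1 by rewrite invr_ge0 ltW.
have G N : majorized_on B ((r / 2)^-1 *+ 2) 1 M (fun y => power_sum c N (y - a)).
  have Gal (al : {ffun 'I_n -> 'I_N}) : majorized_on B ((r / 2)^-1 *+ 2) (0 + 1)
      (`|c (fun i => nat_of_ord (al i))| * (r / 2 *+ 2) ^+ (\sum_(i < n) al i))
      (cst (c (fun i => nat_of_ord (al i))) *
       (fun y : 'rV[K]_n => \prod_(i < n) (y 0 i - a 0 i) ^+ al i)).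
    apply: majorized_mul => //; first by rewrite mulrn_wge0.
      by apply: majorized_cst => //; rewrite mulrn_wge0.
    apply: majorized_monomial => //; last exact: ltW.
      by rewrite divff // gt_eqF.
    move=> i y [_]; rewrite -ball_normE /= distrC => /ltW; apply: le_trans.
    by have := entry_norm_le (y - a) i; rewrite !mxE.
  have A20 : 0 <= (r / 2)^-1 *+ 2 by rewrite mulrn_wge0.
  have := majorized_sum oB A20 (index_enum _) Gal.
  have -> : r / 2 *+ 2 = r by rewrite -[_ *+ 2]mulr_natr divfK // pnatr_eq0.
  move/(majorized_le A20 (leqnn 1) (cM N)); apply: majorized_eq => // y _.
  rewrite fct_sumE; apply: eq_bigr => al _; rewrite [LHS]mulrC.
  by congr (_ *: _); apply: eq_bigr => i _; rewrite !mxE.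
exists B, ((r / 2)^-1 *+ 2), M; split=> //.
- by split; [|exact: (ballxx a r20)].
- by move=> y [].
- exact: mulrn_wge0.
have sgB : smooth_on B g by apply: smooth_on_sub sg => y [].
split=> // s y By.
apply: (partial_limit_le (G := fun N z => power_sum c N (z - a)) (c := fun b =>
  M * ((r / 2)^-1 *+ 2) ^+ b * (rising 1 b)%:R) oB _ sgB _ _ s By).
- by move=> N; have [] := G N.
- by move=> N s' z Bz; have [_ _] := G N; exact.
move=> z [_]; rewrite -ball_normE /= distrC => zr.
have zE : a + (z - a) = z by rewrite addrC subrK.
have := cg (z - a); rewrite zE; apply.
by apply: lt_trans zr _; rewrite ltr_pdivrMr // ltr_pMr // ltr1n.
Qed.

Lemma analytic_coord f a i : analytic_at f a -> analytic_at (fun y => f y 0 i) a.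
Proof.
move=> [c [r [M [r0 cM cf]]]].
exists (fun al => c al 0 i), r, M; split=> //.
  move=> N; apply: le_trans (cM N); apply: ler_sum => al _.
  apply: ler_wpM2r; last exact: entry_norm_le.
  by apply: exprn_ge0; exact: ltW.
move=> h hr.
have -> : (fun N => power_sum (fun al => c al 0 i) N h) =
    (fun N => (power_sum c N h) 0 i).
  by apply/funext => N; rewrite /power_sum summxE; apply: eq_bigr => al _;
    rewrite mxE.
exact: (cvg_comp _ _ (cf h hr) (@coord_continuous K 1 n 0 i (f (a + h)))).
Qed.

Lemma polynomial_majorized U g a : open U -> U a ->
  polynomial_on U g -> majorized_at U a g.
Proof.
move=> oU Ua [p gp].
pose B := U `&` ball a 1.
have oB : open B by apply: openI => //; exact: ball_open.
pose rho := `|a| + 1.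
have rho1 : 1 <= rho by rewrite lerDr.
have rho0 : 0 <= rho by exact: le_trans rho1.
have yrho i y : B y -> `|y 0 i - 0| <= rho.
  move=> [_]; rewrite -ball_normE /= distrC => /ltW ya; rewrite subr0.
  apply: le_trans (entry_norm_le y i) _; rewrite -(subrK a y) addrC /rho.
  by apply: le_trans (ler_normD _ _) _; rewrite lerD2l.
have crho : 1 <= rho * 1 by rewrite mulr1.
have G m : majorized_on B (1 *+ 2) (0 + 1)
    (`|mpoly.mcoeff m p| * (rho *+ 2) ^+ (\sum_(i < n) mpoly.fun_of_multinom m i))
    (cst (mpoly.mcoeff m p) * (fun y : 'rV[K]_n => \prod_(i < n) (y 0 i - 0) ^+
      mpoly.fun_of_multinom m i)).
  apply: majorized_mul => //; first by apply: majorized_cst.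
  exact: (majorized_monomial (mpoly.fun_of_multinom m) oB ler01 crho yrho rho0).
have := majorized_sum oB (ler0n _ 2) (mpoly.msupp p) G.
set M := \sum_(m <- _) _ => H; exists B, (1 *+ 2), M; split=> //.
- by split=> //; exact: ballxx.
- by move=> y [].
apply: majorized_eq H => // y [Uy _].
rewrite gp // mpoly.mevalE fct_sumE; apply: eq_bigr => m _.
by congr (_ * _); apply: eq_bigr => i _; rewrite subr0.
Qed.

End LocalBounds.

(** * Taylor estimates *)

Lemma factorial_coefE (F : fieldType) (P A B x y : F) : x != 0 -> y != 0 ->
  P * A * (x * y) / y * B / x = P * (A * B).
Proof. by move=> x0 y0; field; rewrite x0. Qed.

Lemma factorial_splitE (F : comNzRingType) (G A A' B B' x y : F) :
  G * (A * A') * (B * B' * (x * y)) = G * (A * B) * x * (A' * B') * y.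
Proof. by ring. Qed.

Section TaylorEstimates.
Context {R : realType} {k : scalar_kind}.
Local Notation K := (scalars R k).
Variable T : set K.
Hypothesis tT : time_axis T.

Lemma le_geometric_eq0 (z D c : K) : (forall m : nat, `|z| <= D * 2^-1 ^+ m +
  c) ->
  0 <= D -> 0 <= c -> `|z| <= c.
Proof.
move=> zD D0 c0; apply: le_of_le_eps => // e e0.
have [m Dm] := scalar_archi (D / e).
apply: le_trans (zD m) _; rewrite addrC lerD2l.
rewrite exprVn ler_pdivrMr ?exprn_gt0 // mulrC -ler_pdivrMr //.
apply: le_trans (real_ler_norm (ger0_real _)) _; first by rewrite divr_ge0 // ltW.
by apply: le_trans Dm _; rewrite -natrX ler_nat ltnW // ltn_expl.
Qed.

Lemma sum_half_le N : \sum_(j < N) (2^-1 : K) ^+ j <= 2.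
Proof.
suff -> : \sum_(j < N) (2^-1 : K) ^+ j = 2 - 2 * 2^-1 ^+ N.
  by rewrite lerBlDr lerDl mulr_ge0 // exprn_ge0 // invr_ge0.
elim: N => [|N IH]; first by rewrite big_ord0 expr0 mulr1 subrr.
rewrite big_ord_recr /= IH exprS mulrA divff ?pnatr_eq0 // mul1r.
by rewrite mulr_natl mulr2n opprD addrA subrK.
Qed.

Lemma fact_shift_bound m j : ((m + j)`! <= 2 ^ (m + j) * (m`! * j`!))%N.
Proof.
rewrite -(bin_fact (leq_addr j m)) addKn leq_mul //.
have : ('C(m + j, m) <= \sum_(i < (m + j).+1) 'C(m + j, i))%N.
  have mj : (m < (m + j).+1)%N by rewrite ltnS leq_addr.
  by rewrite (bigD1 (Ordinal mj)) //= leq_addr.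
move/leq_trans; apply; rewrite -[X in (X ^ _)%N]/(1 + 1)%N expnDn.
by under [X in (_ <= X)%N]eq_bigr do rewrite !exp1n !muln1.
Qed.

(** Integrate e_k' = e_(k+1) - w_k repeatedly from t0, starting from the given
    bound on e_(k+m).  All the e_k are estimated at once, by induction on m; the
    factorials in the bounds cancel those produced by integration, leaving
    geometric terms. *)
Lemma taylor_estimate (e w : nat -> K -> K) (t0 t G P M : K) :
  T t0 -> T t -> 0 <= G -> 0 <= P -> 0 <= M ->
  (forall s : R, 0 <= s <= 1 ->
    let tau := t0 + of_real k s * (t - t0) in
    [/\ forall j, derivative_along T (e j) tau (e j.+1 tau - w j tau),
       forall j, `|e j tau| <= G * M ^+ j * j`!%:R &
       forall j, `|w j tau| <= P * M ^+ j.+1 * (j.+1)`!%:R]) ->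
  (forall j, e j t0 = 0) ->
  forall m, `|e 0%N t| <= G * (M * `|t - t0|) ^+ m +
    P * \sum_(j < m) (M * `|t - t0|) ^+ j.+1.
Proof.
move=> Tt0 Tt G0 P0 M0 ew e0 m.
(* b j i comes from w_(j+i), integrated i + 1 times;
g m j from e_(j+m), integrated m times. *)
pose b j (i : nat) : K := P * M ^+ (j + i.+1) * (j + i.+1)`!%:R / i`!%:R.
have b0 j i : 0 <= b j i by rewrite /b !mulr_ge0 ?exprn_ge0 ?invr_ge0.
pose g m j : K := G * M ^+ (j + m) * (j + m)`!%:R / m`!%:R.
have g0 m' j : 0 <= g m' j by rewrite /g !mulr_ge0 ?exprn_ge0 ?invr_ge0.
suff H : forall j (s : R), 0 <= s <= 1 ->
    forall tau, tau = t0 + of_real k s * (t - t0) ->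
    `|e j tau| <= g m j * `|tau - t0| ^+ m +
       \sum_(i < m) b j i * `|tau - t0| ^+ i.+1 / i.+1%:R.
  have := H 0%N 1;
    rewrite ler01 lexx rmorph1 mul1r [t0 + _]addrC subrK => /(_ isT t erefl).
  move/le_trans; apply;
    rewrite /g add0n -[G * _ * _ / _]mulrA divff ?pnatr_eq0 ?gtn_eqF ?fact_gt0 //.
  rewrite mulr1 -mulrA -exprMn lerD2l mulr_sumr ler_sum // => i _.
  rewrite /b add0n factS natrM exprMn.
  by rewrite factorial_coefE // pnatr_eq0 // gtn_eqF ?fact_gt0.
elim: m => [|m IH] j s s01 tau tauE.
  rewrite big_ord0 addr0 expr0 mulr1 /g addn0 divr1.
  by have [_ eG _] := ew s s01; rewrite tauE; exact: eG.
have f1 i : i.+1%:R != 0 :> K by rewrite pnatr_eq0.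
have gS : g m j.+1 / m.+1%:R = g m.+1 j.
  by rewrite /g addSnnS factS natrM invfM !mulrA mulrAC.
have bS i : b j.+1 i / i.+1%:R = b j i.+1.
  by rewrite /b addSnnS [(i.+1)`!]factS natrM invfM !mulrA mulrAC.
(* The term b j 0 is the contribution of w_j itself. *)
pose be i := b j i + (if i == m then g m j.+1 else 0).
have be0 i : 0 <= be i by rewrite addr_ge0 //; case: ifP.
have sumbe (z : nat -> K) : \sum_(i < m.+1) be i * z i =
    \sum_(i < m.+1) b j i * z i + g m j.+1 * z m.
  under eq_bigr do rewrite mulrDl; rewrite big_split /=; congr (_ + _).
  rewrite big_ord_recr /= eqxx big1 ?add0r // => i _.
  by rewrite ltn_eqF // mul0r.
have Ttau : T tau by rewrite tauE; apply: time_axisD => //;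
  apply: time_axisZ => //; exact: time_axisB.
have := @increment_le R k T tT (e j) (fun t => e j.+1 t - w j t) t0 tau be m.+1
  Tt0 Ttau be0.
rewrite e0 subr0.
under eq_bigr do rewrite -mulrA.
rewrite (sumbe (fun i => `|tau - t0| ^+ i.+1 / i.+1%:R)).
rewrite mulrA [_ * _ / m.+1%:R]mulrAC gS => H.
rewrite [X in _ <= X]addrC; under eq_bigr do rewrite -mulrA.
apply: H => s' s'01 tau'.
have tau'E : tau' = t0 + of_real k (s' * s) * (t - t0).
  by rewrite /tau' tauE [t0 + _ - t0]addrAC subrr add0r rmorphM mulrA.
have s's01 : 0 <= s' * s <= 1.
  move/andP: s01 => [s0 s1]; move/andP: s'01 => [s'0 s'1].
  by rewrite mulr_ge0 // mulr_ile1.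
have [De _ wP] := ew _ s's01; have {IH} IH := IH j.+1 _ s's01 _ tau'E.
move: De wP; rewrite /= -tau'E => De wP; split; first exact: De.
rewrite (sumbe (fun i => `|tau' - t0| ^+ i)).
apply: le_trans (ler_normB _ _) _.
rewrite big_ord_recl /= expr0 mulr1 -[X in _ <= X]addrA [X in _ <= X]addrC.
apply: lerD.
  apply: le_trans IH _; rewrite [X in X <= _]addrC lerD2r; apply: ler_sum => i _.
  by rewrite mulrAC bS.
by apply: le_trans (wP j) _; rewrite /b fact0 divr1 addn1.
Qed.

(** Shifting the sequence turns the claim for e_j into that for e_0, at the cost
    of doubling M. *)
Lemma taylor_vanish (e : nat -> K -> K) (t0 t G M : K) :
  T t0 -> T t -> 0 <= G -> 0 <= M -> M * `|t - t0| <= 4^-1 ->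
  (forall s : R, 0 <= s <= 1 ->
    let tau := t0 + of_real k s * (t - t0) in
    (forall j, derivative_along T (e j) tau (e j.+1 tau)) /\
    (forall j, `|e j tau| <= G * M ^+ j * j`!%:R)) ->
  (forall j, e j t0 = 0) -> forall j, e j t = 0.
Proof.
move=> Tt0 Tt G0 M0 Mt eG e0 j.
pose G' := G * (M *+ 2) ^+ j * j`!%:R.
have G'0 : 0 <= G' by rewrite !mulr_ge0 ?exprn_ge0 ?mulrn_wge0.
have H := @taylor_estimate (fun i => e (j + i)%N) (fun _ => cst 0) t0 t G' 0 (M
  *+ 2)
  Tt0 Tt G'0 (lexx 0) (mulrn_wge0 2 M0) _ (fun i => e0 _).
apply/eqP; rewrite -normr_le0; apply: (@le_geometric_eq0 _ G') => // m.
rewrite addr0 -[X in e X t](addn0 j); apply: le_trans (H _ m) _.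
  move=> s s01 tau; have [De eb] := eG s s01; split=> i.
  - by rewrite subr0 addnS; exact: De.
  - apply: le_trans (eb _) _.
    have : ((j + i)`!%:R : K) <= (2 ^ (j + i) * (j`! * i`!))%:R.
      by rewrite ler_nat fact_shift_bound.
    move=> /(ler_wpM2l (mulr_ge0 G0 (exprn_ge0 (j + i) M0))) /le_trans; apply.
    rewrite !natrM natrX /G' -[M *+ 2]mulr_natr !exprMn !exprD.
    by rewrite factorial_splitE.
  - by rewrite normr0 !mul0r.
rewrite mul0r addr0 ler_wpM2l // lerXn2r ?nnegrE ?mulr_ge0 ?mulrn_wge0
  ?invr_ge0 //.
rewrite mulrnAl -[X in X <= _]mulr_natr; apply: le_trans (ler_wpM2r _ Mt) _ => //.
by rewrite -[4]/((2 * 2)%:R) natrM invfM mulfVK // pnatr_eq0.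
Qed.

End TaylorEstimates.

(** * Functions along solutions *)

Lemma half_half_split (F : numFieldType) (e a C h : F) : a != 0 -> C != 0 ->
  e * h = e / 2 / a * (a * h) + C * (e / 2 / C * h).
Proof. by move=> a0 C0; field; rewrite ?a0 ?C0. Qed.

Section ChainRule.
Context {K : numFieldType} (T : set K).

Lemma derivative_along_near (V : normedModType K) (x : K -> V) t v :
  derivative_along T x t v <->
  forall e, 0 < e -> \forall h \near (0 : K),
    T h -> `|x (t + h) - x t - h *: v| <= e * `|h|.
Proof.
split=> [/derivative_alongP xv e /xv[r r0 rP]|xv].
  apply/nbhs_ballP; exists r => //= h; rewrite /ball /= sub0r normrN => hr Th.
  exact: rP.
apply/derivative_alongP => e /xv /nbhs_ballP[r /= r0 rP]; exists r => // h Th hr.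
by apply: rP => //; rewrite /ball /= sub0r normrN.
Qed.

Lemma derivative_along_lipschitz (V : normedModType K) (x : K -> V) t v :
  derivative_along T x t v ->
  \forall h \near (0 : K), T h -> `|x (t + h) - x t| <= (1 + `|v|) * `|h|.
Proof.
move=> /derivative_along_near /(_ 1 ltr01); apply: filterS => h H /H {}H.
have -> : x (t + h) - x t = (x (t + h) - x t - h *: v) + h *: v by rewrite subrK.
by apply: le_trans (ler_normD _ _) _; rewrite mulrDl lerD // normrZ mulrC.
Qed.

Lemma derivative_along_continuous (V : normedModType K) (x : K -> V) t v (N :
  set V) :
  derivative_along T x t v -> nbhs (x t) N ->
  \forall h \near (0 : K), T h -> N (x (t + h)).
Proof.
move=> /derivative_along_lipschitz xv /nbhs_ballP[r /= r0 rN].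
have v1 : 0 < 1 + `|v| by rewrite ltr_pwDl.
have : \forall h \near (0 : K), `|h| < r / (1 + `|v|).
  by apply: (@nbhs0_lt K K); rewrite divr_gt0.
move/(filterI xv); apply: filterS => h [H hr] /H {}H.
apply: rN; rewrite -ball_normE /= distrC; apply: le_lt_trans H _.
by rewrite mulrC -ltr_pdivlMr.
Qed.

Lemma chain_along (V W : normedModType K) (psi : V -> W) (x : K -> V) t v :
  differentiable psi (x t) -> derivative_along T x t v ->
  derivative_along T (fun s => psi (x s)) t ('d psi (x t) v).
Proof.
move=> dpsi xv; apply/derivative_along_near => e e0.
have [C C0 dC] := linear_lipschitz (diff_continuous dpsi).
have v1 : 0 < 1 + `|v| by rewrite ltr_pwDl.
have e1 : 0 < e / 2 / (1 + `|v|) by rewrite !divr_gt0.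
have e2 : 0 < e / 2 / C by rewrite !divr_gt0.
have /eqaddoP /(_ _ e1) := diff_locally dpsi.
rewrite !fctE => psiN.
have psiN' : nbhs (x t) [set y | `|psi y - psi (x t) - 'd psi (x t) (y - x t)|
     <= e / 2 / (1 + `|v|) * `|y - x t|].
  have /nbhs_ballP[r /= r0 rP] : nbhs 0 [set w | `|psi (w + x t) -
      (psi (x t) + 'd psi (x t) w)| <= e / 2 / (1 + `|v|) * `|w|] by exact: psiN.
  apply/nbhs_ballP; exists r => //= y; rewrite -ball_normE /= => yr.
  have := rP (y - x t); rewrite /= subrK opprD addrA; apply.
  by rewrite -ball_normE /= sub0r opprB.
have H1 := derivative_along_continuous xv psiN'.
have H2 := derivative_along_lipschitz xv.
have H3 := (derivative_along_near x t v).1 xv _ e2.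
apply: filterS (filterI (filterI H1 H2) H3) => h [[A1 A2] A3] Th.
have {A1}A1 := A1 Th; have {A2}A2 := A2 Th; have {A3}A3 := A3 Th.
have -> : psi (x (t + h)) - psi (x t) - h *: 'd psi (x t) v =
   (psi (x (t + h)) - psi (x t) - 'd psi (x t) (x (t + h) - x t)) +
   'd psi (x t) (x (t + h) - x t - h *: v).
  set w := x (t + h) - x t.
  have -> : 'd psi (x t) (w - h *: v) = 'd psi (x t) w - h *: 'd psi (x t) v.
    by rewrite linearB linearZ.
  by rewrite addrA subrK.
have -> : e * `|h| = e / 2 / (1 + `|v|) * ((1 + `|v|) * `|h|) + C * (e / 2 / C
  * `|h|).
  by apply: half_half_split; rewrite gt_eqF.
apply: le_trans (ler_normD _ _) _; apply: lerD.
  by apply: le_trans A1 _; rewrite ler_wpM2l // ltW.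
by apply: le_trans (dC _) _; rewrite ler_wpM2l // ltW.
Qed.

End ChainRule.

Section Solutions.
Context {R : realType} {k : scalar_kind} {n : nat}.
Local Notation K := (scalars R k).
Variables (T : set K) (U : set 'rV[K]_n) (f : 'rV[K]_n -> 'rV[K]_n).
Hypotheses (tT : time_axis T) (oU : open U) (sf : smooth_on U f).
Implicit Types (D : set K) (x : K -> 'rV[K]_n) (psi : 'rV[K]_n -> K).

Lemma lie_along D x psi j t : solution T D U f x -> smooth_on U psi -> D t ->
  derivative_along T (fun s => iter j (lie_derivative f) psi (x s)) t
    (iter j.+1 (lie_derivative f) psi (x t)).
Proof.
move=> xsol spsi Dt; have [Uxt xt] := xsol t Dt.
apply: (chain_along _ xt).
exact: smooth_on_differentiable (smooth_on_iter_lie j oU sf spsi) Uxt.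
Qed.

Lemma time_domain_near D t : time_domain T D -> D t ->
  T t /\ \forall h \near (0 : K), T h -> D (t + h).
Proof.
move=> [_ _ [Q oQ DE]]; rewrite DE => - [Ot Tt]; split=> //.
have /nbhs_ballP[r /= r0 rO] : nbhs t Q by exact: open_nbhs_nbhs.
apply/nbhs_ballP; exists r => //= h hr Th; split; last exact: time_axisD.
by apply: rO; move: hr;
  rewrite /ball /= sub0r normrN opprD addrA subrr sub0r normrN.
Qed.

Lemma derivative_along_unique0 (u : K -> K) t v :
  derivative_along T u t v -> (\forall h \near (0 : K), T h -> u (t + h) = 0) ->
  v = 0.
Proof.
move=> uv u0.
have ut : u t = 0.
  have := nbhs_singleton u0; rewrite addr0; apply.
  by rewrite -(rmorph0 (of_real k)); exact: time_axis_of_real.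
apply/eqP; rewrite -normr_le0; apply: le_of_le_eps => // e e0; rewrite add0r.
have /(_ e e0) := (derivative_along_near _ _ _ _).1 uv.
move/(filterI u0) => /nbhs_ballP[r /= r0 rP].
have r20 : 0 < r / 2 by rewrite divr_gt0.
have Th : T (r / 2) by rewrite (ge0_of_real (ltW r20)); exact: time_axis_of_real.
have /rP[/(_ Th) zr /(_ Th)] : ball (0 : K) r (r / 2).
  rewrite /ball /= sub0r normrN gtr0_norm // ltr_pdivrMr // ltr_pMr // ltr1n //.
by rewrite zr ut subrr sub0r normrN normrM mulrC ler_pM2r ?normr_gt0 ?gt_eqF.
Qed.

(** Differentiating psi(x(t)) = 0 in t gives (X_f psi)(x(t)) = 0. *)
Lemma side_condition_lie_zero D x psi : time_domain T D -> solution T D U f x ->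
  smooth_on U psi -> (forall t, D t -> psi (x t) = 0) ->
  forall j t, D t -> iter j (lie_derivative f) psi (x t) = 0.
Proof.
move=> tD xsol spsi psi0; elim=> [|j IH] t Dt; first exact: psi0.
apply: (derivative_along_unique0 (lie_along (j := j) xsol spsi Dt)).
have [_] := time_domain_near tD Dt.
by apply: filterS => h H /H; exact: IH.
Qed.

End Solutions.

(** * Invariance of the common zero set *)

Lemma derivative_boundE (F : comNzRingType) (C P L x y : F) :
  C * (P * L) * (x * y) = C * P * y * (L * x).
Proof. by ring. Qed.

Section Invariance.
Context {R : realType} {k : scalar_kind} {n : nat}.
Local Notation K := (scalars R k).
Variables (T : set K) (U : set 'rV[K]_n) (f : 'rV[K]_n -> 'rV[K]_n).
Hypotheses (tT : time_axis T) (oU : open U) (sf : smooth_on U f).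
Implicit Types (D : set K) (x : K -> 'rV[K]_n) (psi : 'rV[K]_n -> K).

Hypothesis gf : forall a i, U a -> majorized_at U a (fun y => f y 0 i).

(** Cauchy estimates for iterated Lie derivatives, with the first derivatives
    that the equation for the defects of the Lie series calls for. *)
Lemma lie_bounds (J : finType) (g : J -> 'rV[K]_n -> K) a : U a ->
  (forall j, majorized_at U a (g j)) ->
  exists B C L, [/\ open B, B a, B `<=` U, (0 <= C) && (0 <= L) &
    forall j m y, B y ->
      `|iter m (lie_derivative f) (g j) y| <= C * L ^+ m * m`!%:R /\
      forall l, `|'D_(delta_mx 0 l) (iter m (lie_derivative f) (g j)) y| <=
        C * L ^+ m.+1 * (m.+1)`!%:R].
Proof.
move=> Ua gg.
(* The components of f and the functions g j share one neighbourhood. *)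
pose G (i : 'I_n + J) := match i with inl i => fun y => f y 0 i | inr j => g j
  end.
have [|B [A [C [oB Ba BU /andP[A0 C0] H]]]] := @majorized_at_family R k n U a _
  G oU Ua.
  by case=> [i|j]; [exact: gf|exact: gg].
have fC i : majorized_on B A 1 C (fun y => f y 0 i) by exact: (H (inl i)).
pose L0 := n%:R * C * A *+ 2.
have L00 : 0 <= L0 by rewrite mulrn_wge0 // !mulr_ge0.
have A20 : 0 <= A *+ 2 by rewrite mulrn_wge0.
have L0L : L0 <= L0 + A *+ 2 by rewrite lerDl.
exists B, C, (L0 + A *+ 2); split=> //; first by rewrite C0 addr_ge0.
move=> j m y By.
have Gm := majorized_iter_lie m oB A0 C0 fC (H (inr j)).
have CL : C * L0 ^+ m * m`!%:R <= C * (L0 + A *+ 2) ^+ m * m`!%:R.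
  by rewrite ler_wpM2r // ler_wpM2l // lerXn2r // nnegrE addr_ge0.
split; first exact: le_trans (majorized_bound Gm By) CL.
move=> l; have Gl := majorized_derive A0 l Gm.
apply: le_trans (majorized_bound Gl By) _; rewrite -mulrA.
rewrite factS natrM exprSr derivative_boundE; apply: ler_pM => //.
- by rewrite !mulr_ge0 ?exprn_ge0.
- by rewrite mulr_ge0.
rewrite mulrDl; apply: (@le_trans _ _ (A *+ 2 * m.+1%:R));
  last by rewrite lerDr mulr_ge0.
by rewrite mulrnAl -mulrnAr ler_wpM2l // -mulrnA ler_nat muln2 doubleS.
Qed.

(** Local form of invariance, from the vanishing of all Taylor coefficients of
    psi(x(t)) at t0. *)
Lemma lie_zeros_near D x psi t0 : time_domain T D -> solution T D U f x -> D t0 ->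
  smooth_on U psi -> majorized_at U (x t0) psi ->
  (forall j, iter j (lie_derivative f) psi (x t0) = 0) ->
  \forall h \near (0 : K), T h -> D (t0 + h) /\
    forall j, iter j (lie_derivative f) psi (x (t0 + h)) = 0.
Proof.
move=> tD xsol Dt0 spsi gpsi z0; have [Uxt0 xt0] := xsol _ Dt0.
have [Tt0 nD] := time_domain_near tT tD Dt0.
have [|B [C [L [oB Bx BU /andP[C0 L0] H]]]] := @lie_bounds unit (fun=> psi) _
  Uxt0.
  by [].
have nB : \forall h \near (0 : K), T h -> B (x (t0 + h)).
  by apply: derivative_along_continuous xt0 _; exact: open_nbhs_nbhs.
have L1 : 0 < L + 1 by rewrite ltr_wpDl.
have nL : \forall h \near (0 : K), `|h| < 4^-1 / (L + 1).
  by apply: (@nbhs0_lt K K); rewrite divr_gt0 // invr_gt0.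
have /nbhs_ballP[r /= r0 rP] : \forall h \near (0 : K),
    ((T h -> D (t0 + h)) /\ (T h -> B (x (t0 + h)))) /\ `|h| < 4^-1 / (L + 1).
  exact: filterI (filterI nD nB) nL.
apply/nbhs_ballP; exists r => //= h hr Th.
have [[Dh _] hL] := rP h hr; split; first exact: Dh.
apply: (@taylor_vanish R k T tT (fun j u => iter j (lie_derivative f) psi (x u))
  t0 (t0 + h) C (L + 1)) => //.
- exact: time_axisD.
- exact: ltW.
- by rewrite [t0 + h]addrC addrK mulrC -ler_pdivlMr // ltW.
move=> s s01 tau.
have tauE : tau = t0 + of_real k s * h by rewrite /tau [t0 + h]addrC addrK.
have [[Dtau Btau] _] : ((T (of_real k s * h) -> D (t0 + of_real k s * h)) /\
    (T (of_real k s * h) -> B (x (t0 + of_real k s * h)))) /\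
    `|of_real k s * h| < 4^-1 / (L + 1).
  apply: rP; move: hr; rewrite /ball /= !sub0r !normrN; apply: le_lt_trans.
  exact: norm_segment_le.
have Tsh : T (of_real k s * h) by exact: time_axisZ.
split=> j; rewrite tauE.
  exact: (lie_along oU sf (j := j) xsol spsi (Dtau Tsh)).
have [jb _] := H tt j _ (Btau Tsh); apply: le_trans jb _.
by rewrite ler_wpM2r // ler_wpM2l // lerXn2r // ?nnegrE ?lerDl // ltW.
Qed.

Lemma lie_zeros_invariant s (gamma : 'I_s -> 'rV[K]_n -> K) :
  (forall j, smooth_on U (gamma j)) ->
  (forall a j, U a -> majorized_at U a (gamma j)) ->
  flow_invariant T U f (lie_common_zeros U f gamma).
Proof.
move=> sg gg D x tD xsol t0 t Dt0 Dt Wt0.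
have [_ cD _] := tD.
pose W := lie_common_zeros U f gamma.
pose Z := D `&` [set t | W (x t)].
suff ZD : Z = D by move: Dt; rewrite -ZD => -[].
apply: cD; first by exists t0.
  (* Openness in D, from the local statement. *)
  exists (interior [set t | D t -> W (x t)]); first exact: open_interior.
  apply/seteqP; split=> t' [Dt' Wt']; last by split=> //;
    exact: (interior_subset Wt').
  split=> //.
  have [Ut' zt'] := Wt'; have [Tt' _] := time_domain_near tT tD Dt'.
  have : \forall h \near (0 : K), forall j, T h -> D (t' + h) /\
      forall i, iter i (lie_derivative f) (gamma j) (x (t' + h)) = 0.
    apply: (@filter_forall K 'I_s (fun j h => T h -> D (t' + h) /\
      forall i, iter i (lie_derivative f) (gamma j) (x (t' + h)) = 0) (nbhs 0))
        => j; apply: (lie_zeros_near tD xsol Dt' (sg j)).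
      exact: gg.
    by move=> i; exact: zt'.
  move=> /nbhs_ballP[r /= r0 rP]; apply/nbhs_ballP; exists r => //= u ur Du.
  have [Tu _] := time_domain_near tT tD Du.
  have uE : t' + (u - t') = u by rewrite addrC subrK.
  have ur' : ball (0 : K) r (u - t').
    by move: ur; rewrite /ball /= sub0r opprB.
  split; first by have [] := xsol _ Du.
  by move=> i j; have [_ +] := rP _ ur' j (time_axisB tT Tu Tt'); rewrite uE;
    exact.
(* Closedness in D, by continuity of each X_f^i(gamma_j) along x. *)
exists (closure Z); first exact: closed_closure.
apply/seteqP; split=> t' [Dt' Zt'].
  by split=> //; apply: subset_closure; split.
split=> //.
have [Ut' xt'] := xsol _ Dt'; have [Tt' _] := time_domain_near tT tD Dt'.
split=> // i j; apply: contrapT => /eqP z0.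
set z := iter _ _ _ _ in z0; have zn0 : 0 < `|z| by rewrite normr_gt0.
have /nbhs_ballP[r /= r0 rP] := derivative_along_continuous
  (lie_along oU sf (j := i) xsol (sg j) Dt') (nbhsx_ballx z _ zn0).
have [t'' [[Dt'' [_ Wt'']] t'r]] := Zt' _ (nbhsx_ballx t' r r0).
have [Tt'' _] := time_domain_near tT tD Dt''.
have tr : ball (0 : K) r (t'' - t') by move: t'r; rewrite /ball /= sub0r opprB.
have := rP _ tr (time_axisB tT Tt'' Tt').
by rewrite [t' + _]addrC subrK /ball /= Wt'' subr0 ltxx.
Qed.

End Invariance.

(** * Exponential series *)

Lemma cancel_factor (F : fieldType) (c x y t : F) : x != 0 -> y != 0 ->
  c / y * t = c / (x * y) * (x * t).
Proof. by move=> x0 y0; field; rewrite ?x0 ?y0. Qed.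

Section ExponentialSeries.
Context {R : realType} {k : scalar_kind}.
Local Notation K := (scalars R k).
Implicit Types (c : nat -> K) (t : K).

Lemma real_geometric_cvg (v : nat -> R) (C : R) :
  (forall N, `|v N.+1 - v N| <= C * 2^-1 ^+ N) -> cvgn v.
Proof.
move=> vC.
have C0 : 0 <= C by have := le_trans (normr_ge0 _) (vC 0%N); rewrite expr0 mulr1.
have -> : v = (fun N => v 0%N + series (telescope v) N).
  by apply/funext => N; rewrite -eq_sum_telescope.
apply: is_cvgD; first exact: is_cvg_cst.
apply: normed_cvg; apply: (@series_le_cvg R _ (geometric C 2^-1)).
- by move=> N /=.
- by move=> N /=; rewrite mulr_ge0 // exprn_ge0.
- by move=> N /=; exact: vC.
by apply: is_cvg_geometric_series;
  rewrite ger0_norm ?invr_ge0 // invf_lt1 // ltr1n.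
Qed.

Lemma scalar_geometric_cvg (u : nat -> K) (C : K) :
  (forall N, `|u N.+1 - u N| <= C * 2^-1 ^+ N) -> cvgn u.
Proof.
move=> uC.
have C0 : 0 <= C by have := le_trans (normr_ge0 _) (uC 0%N); rewrite expr0 mulr1.
have uC' N : `|u N.+1 - u N| <= of_real k (re_part C * 2^-1 ^+ N).
  apply: le_trans (uC N) _; rewrite rmorphM rmorphXn fmorphV rmorph_nat.
  by rewrite -ge0_of_real.
have /cvg_ex[/= a va] : cvgn (fun N => re_part (u N)).
  apply: (@real_geometric_cvg _ (re_part C)) => N.
  rewrite -re_partN -re_partD -(ler_of_real (k := k)).
  exact: le_trans (re_part_norm _) (uC' N).
have imN (z : K) : im_part (- z) = - im_part z.
  by apply/eqP; rewrite -addr_eq0 -im_partD addNr; case: (k).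
have /cvg_ex[/= b vb] : cvgn (fun N => im_part (u N)).
  apply: (@real_geometric_cvg _ (re_part C)) => N.
  rewrite -imN -im_partD -(ler_of_real (k := k)).
  exact: le_trans (im_part_norm _) (uC' N).
apply/cvg_ex; exists (of_real k a + imag_unit * of_real k b).
have -> : u = (fun N => of_real k (re_part (u N)) + imag_unit * of_real k
  (im_part (u N))).
  by apply/funext => N; rewrite -scalarE.
have ra := continuous_cvg _ (@of_real_continuous R k a) va.
have rb := continuous_cvg _ (@of_real_continuous R k b) vb.
apply: cvgD; first exact: ra.
apply: cvgM; first exact: cvg_cst.
exact: rb.
Qed.

Definition exp_sum c (N : nat) t : K := \sum_(j < N) c j / j`!%:R * t ^+ j.

Definition exp_series c t : K := lim (exp_sum c N t @[N --> \oo]).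

Definition factorially_bounded (C L : K) c := forall j, `|c j| <= C * L ^+ j *
  j`!%:R.

Lemma exp_sum_term C L c t j : factorially_bounded C L c ->
  `|c j / j`!%:R * t ^+ j| <= C * (L * `|t|) ^+ j.
Proof.
move=> cC; rewrite !normrM normfV normrX normr_nat exprMn mulrA.
by rewrite ler_wpM2r ?exprn_ge0 // ler_pdivrMr ?ltr0n ?fact_gt0.
Qed.

Section Bounded.
Variables (C L : K) (c : nat -> K).
Hypotheses (C0 : 0 <= C) (L0 : 0 <= L) (cC : factorially_bounded C L c).

Lemma exp_sum_term_half t j : L * `|t| <= 2^-1 ->
  `|c j / j`!%:R * t ^+ j| <= C * 2^-1 ^+ j.
Proof.
move=> Lt; apply: le_trans (exp_sum_term t j cC) _.
by rewrite ler_wpM2l // lerXn2r // nnegrE ?mulr_ge0 ?invr_ge0.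
Qed.

Lemma exp_sum_le t N : L * `|t| <= 2^-1 -> `|exp_sum c N t| <= C * 2.
Proof.
move=> Lt; apply: le_trans (ler_norm_sum _ _ _) _.
apply: (@le_trans _ _ (\sum_(j < N) C * 2^-1 ^+ j)).
  by apply: ler_sum => j _; exact: exp_sum_term_half.
by rewrite -mulr_sumr ler_wpM2l // sum_half_le.
Qed.

Lemma exp_sum_cvg t : L * `|t| <= 2^-1 ->
  exp_sum c N t @[N --> \oo] --> exp_series c t.
Proof.
move=> Lt; apply: (@scalar_geometric_cvg _ C) => N.
rewrite /exp_sum big_ord_recr /= addrAC subrr add0r; exact: exp_sum_term_half.
Qed.

Lemma exp_series_le t : L * `|t| <= 2^-1 -> `|exp_series c t| <= C * 2.
Proof. by move=> Lt; apply: norm_limit_le (exp_sum_cvg Lt) _ => N;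
  exact: exp_sum_le. Qed.

Lemma exp_series0 : exp_series c 0 = c 0%N.
Proof.
have L00 : L * `|0 : K| <= 2^-1 by rewrite normr0 mulr0 invr_ge0.
have := exp_sum_cvg L00; rewrite -cvg_shiftS => H.
apply/esym; apply: (cvg_unique _ _ H) => //.
have -> : (fun N => exp_sum c N.+1 0) = cst (c 0%N); last exact: cvg_cst.
apply/funext => N; rewrite /exp_sum big_ord_recl big1 /=.
  by rewrite fact0 divr1 expr0 mulr1 addr0.
by move=> j _; rewrite /bump /= add1n expr0n /= mulr0.
Qed.

Lemma factorially_bounded_shift m :
  factorially_bounded (C * (L *+ 2) ^+ m * m`!%:R) (L *+ 2) (fun j => c (m +
    j)%N).
Proof.
move=> j; apply: le_trans (cC _) _.
have : ((m + j)`!%:R : K) <= (2 ^ (m + j) * (m`! * j`!))%:R.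
  by rewrite ler_nat fact_shift_bound.
move=> /(ler_wpM2l (mulr_ge0 C0 (exprn_ge0 (m + j) L0))) /le_trans; apply.
rewrite !natrM natrX -[L *+ 2]mulr_natr !exprMn !exprD.
by rewrite factorial_splitE.
Qed.

End Bounded.

Lemma exp_sum_derive c N t :
  derivative_along setT (exp_sum c N.+1) t (exp_sum (fun j => c j.+1) N t).
Proof.
have D : is_derive t 1 (\sum_(j < N.+1) (c j / j`!%:R) *: (@id K ^+ j))
   (\sum_(j < N.+1) (c j / j`!%:R) *: ((j%:R * t ^+ j.-1) *: 1)).
  by apply: is_derive_sum => j; apply: is_deriveZ.
have [dD vD] := D.
rewrite /derivative_along withinET.
have E : (fun h : K => h^-1 *: (exp_sum c N.+1 (t + h) - exp_sum c N.+1 t)) =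
  (fun h => h^-1 *: ((\sum_(j < N.+1) (c j / j`!%:R) *: (@id K ^+ j)) (h *: 1 +
    t) -
     (\sum_(j < N.+1) (c j / j`!%:R) *: (@id K ^+ j)) t)).
  apply/funext => h; rewrite !fct_sumE [h *: 1]mulr1 [h + t]addrC.
  by congr (_ *: (_ - _)); apply: eq_bigr => j _; rewrite !fctE.
rewrite E.
have -> : exp_sum (fun j => c j.+1) N t =
   \sum_(j < N.+1) (c j / j`!%:R) *: ((j%:R * t ^+ j.-1) *: 1).
  rewrite big_ord_recl mul0r scale0r scaler0 add0r; apply: eq_bigr => j _.
  rewrite /bump /= ?add1n [_ *: 1]mulr1 factS natrM.
  by apply: cancel_factor; rewrite pnatr_eq0 // gtn_eqF // fact_gt0.
rewrite -vD; exact: dD.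
Qed.

(** The second-order estimate for p_N, with a constant independent of N, passes
    to the limit and is then an estimate for the derivative of P. *)
Lemma limit_derivative (p q r : nat -> K -> K) (P Q : K -> K) (d C t : K) :
  0 <= C ->
  (forall s, `|s| < d -> [/\ forall N, derivative_along setT (p N) s (q N s),
     forall N, derivative_along setT (q N) s (r N s),
     forall N, `|r N s| <= C, p N s @[N --> \oo] --> P s & q N s @[N --> \oo]
       --> Q s]) ->
  `|t| < d -> derivative_along setT P t (Q t).
Proof.
move=> C0 H td.
have dt : 0 < d - `|t| by rewrite subr_gt0.
have C1 : 0 < C + 1 by rewrite ltr_wpDl.
apply/derivative_along_near => e e0.
have n1 : \forall h \near (0 : K), `|h| < d - `|t| by exact: (@nbhs0_lt K K).
have n2 : \forall h \near (0 : K), `|h| < e / (C + 1).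
  by apply: (@nbhs0_lt K K); rewrite divr_gt0.
apply: filterS (filterI n1 n2) => h [hd he] _.
have sh (s : R) : 0 <= s <= 1 -> `|t + of_real k s * h| < d.
  move=> s01; apply: le_lt_trans (ler_normD _ _) _.
  rewrite addrC -ltrBrDr; apply: le_lt_trans hd; exact: norm_segment_le.
have thd : `|t + h| < d.
  by have := sh 1; rewrite ler01 lexx rmorph1 mul1r; apply.
apply: (@le_trans _ _ (C * `|h| ^+ 2)).
  have [_ _ _ pt qt] := H _ td; have [_ _ _ pth _] := H _ thd.
  have L : (p N (t + h) - p N t - h * q N t) @[N --> \oo] --> P (t + h) - P t -
    h * Q t.
    by apply: cvgB; [exact: cvgB|apply: cvgM => //; exact: cvg_cst].
  apply: norm_limit_le L _ => N.
  apply: (@second_order_along _ _ _ _ (r N)) => // s /sh tau.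
  by have [pD qD rC _ _] := H _ tau.
rewrite expr2 mulrA ler_wpM2r //; move: he;
  rewrite ltr_pdivlMr // mulrDr mulr1 => /ltW.
by apply: le_trans; rewrite mulrC lerDl.
Qed.

Lemma exp_series_derive (C L d : K) c t : 0 <= C -> 0 <= L ->
  factorially_bounded C L c -> L * d <= 4^-1 -> `|t| < d ->
  derivative_along setT (exp_series c) t (exp_series (fun j => c j.+1) t).
Proof.
move=> C0 L0 cC Ld.
have c1 := factorially_bounded_shift C0 L0 cC 1.
have c2 := factorially_bounded_shift C0 L0 cC 2.
have L20 : 0 <= L *+ 2 by rewrite mulrn_wge0.
pose C1 m := C * (L *+ 2) ^+ m * m`!%:R.
have C10 m : 0 <= C1 m by rewrite !mulr_ge0 ?exprn_ge0.
have half : (4^-1 : K) *+ 2 = 2^-1.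
  by rewrite -[4]/((2 * 2)%:R) natrM invfM -[LHS]mulr_natr mulfVK // pnatr_eq0.
apply: (@limit_derivative (fun N => exp_sum c N.+2)
  (fun N => exp_sum (fun j => c j.+1) N.+1) (fun N => exp_sum (fun j => c j.+2) N)
  _ _ _ (C1 2 * 2)); first by rewrite mulr_ge0.
move=> s sd.
have Ls4 : L * `|s| <= 4^-1 by apply: le_trans Ld; rewrite ler_wpM2l // ltW.
have Ls2 : L *+ 2 * `|s| <= 2^-1 by rewrite mulrnAl -half lerMn2r Ls4.
have Ls : L * `|s| <= 2^-1.
  by apply: le_trans Ls4 _; rewrite lef_pV2 ?posrE // ler_nat.
split.
- by move=> N; exact: exp_sum_derive.
- by move=> N; exact: exp_sum_derive.
- by move=> N; exact: (exp_sum_le (C10 2) L20 c2 N Ls2).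
- have := exp_sum_cvg C0 L0 cC Ls; rewrite -cvg_shiftS => H.
  by move: H; rewrite -(cvg_shiftS (fun N => exp_sum c N.+1 s)).
- by have := exp_sum_cvg (C10 1) L20 c1 Ls2; rewrite -cvg_shiftS.
Qed.

End ExponentialSeries.

(** * Existence of solutions *)

Lemma contraction_factorE (F : numFieldType) (n eta C M t : F) :
  n * eta * C * (M * t * 2) = n * C * M *+ 4 * t * (eta / 2).
Proof. by field. Qed.

Section Existence.
Context {R : realType} {k : scalar_kind} {n : nat}.
Local Notation K := (scalars R k).
Variables (U : set 'rV[K]_n) (f : 'rV[K]_n -> 'rV[K]_n).
Hypotheses (oU : open U) (sf : smooth_on U f).
Hypothesis gf : forall a i, U a -> majorized_at U a (fun y => f y 0 i).

Lemma row_norm_le (v : 'rV[K]_n) c : 0 <= c -> (forall i, `|v 0 i| <= c) ->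
  `|v| <= c.
Proof.
move=> c0 vc.
have [v0|v0] := eqVneq (mx_norm v) 0; first by rewrite [`|v|]v0.
have [[i j] vE] := mx_norm_neq0 v0; rewrite [`|v|]vE /= ord1; exact: vc.
Qed.

Lemma derivative_along_row (T : set K) (x : K -> 'rV[K]_n) t (v : 'rV[K]_n) :
  (forall i, derivative_along T (fun s => x s 0 i) t (v 0 i)) ->
  derivative_along T x t v.
Proof.
move=> xv; apply/derivative_along_near => e e0.
have : \forall h \near (0 : K), forall i, T h ->
    `|x (t + h) 0 i - x t 0 i - h *: v 0 i| <= e * `|h|.
  apply: (@filter_forall K 'I_n (fun i h => T h ->
    `|x (t + h) 0 i - x t 0 i - h *: v 0 i| <= e * `|h|) (nbhs 0)) => i.
  exact: (derivative_along_near _ _ _ _).1 (xv i) e e0.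
apply: filterS => h H Th; apply: row_norm_le; first by rewrite mulr_ge0 // ltW.
by move=> i; rewrite !mxE; exact: H.
Qed.

(** The Lie series at a solves the equation, the defects e being contracted to
    zero on a small disc. *)
Lemma local_solution a : U a ->
  exists2 d, 0 < d & exists2 x : K -> 'rV[K]_n, x 0 = a &
    forall t, `|t| < d -> U (x t) /\ derivative_along setT x t (f (x t)).
Proof.
move=> Ua.
have [|B [C [L [oB Ba BU /andP[C0 L0] HB]]]] :=
    @lie_bounds R k n U f oU gf 'I_n (fun i y => f y 0 i) a Ua.
  by move=> j; exact: gf.
pose X m i := iter m (lie_derivative f) (fun y => f y 0 i).
have sX m i : smooth_on U (X m i).
  by apply: smooth_on_iter_lie => //; exact: smooth_on_coord.
pose M := L *+ 2 + 1.
have L20 : 0 <= L *+ 2 by rewrite mulrn_wge0.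
have M0 : 0 < M by rewrite ltr_wpDl.
have M0' := ltW M0.
have LM : L <= M by rewrite /M mulr2n -addrA lerDl addr_ge0.
(* Taylor coefficients at a of the components of f along the flow; c is the
   sequence d preceded by the coordinates of a. *)
pose d i j := X j i a.
pose c i j := if j is j'.+1 then d i j' else a 0 i.
have db i m : factorially_bounded (C * M ^+ m * m`!%:R) M (fun j => d i (m +
  j)%N).
  have dL : factorially_bounded C L (d i) by move=> j; have [] := HB i j a Ba.
  move=> j; apply: le_trans (factorially_bounded_shift C0 L0 dL m j) _.
  rewrite ler_wpM2r //; apply: ler_pM; rewrite ?mulr_ge0 ?exprn_ge0 //.
    by rewrite ler_wpM2r // ler_wpM2l // lerXn2r ?nnegrE // lerDl.
  by rewrite lerXn2r ?nnegrE // lerDl.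
have Cm0 m : 0 <= C * M ^+ m * m`!%:R by rewrite !mulr_ge0 ?exprn_ge0.
have cb i : factorially_bounded (C + `|a|) M (c i).
  move=> [|j] /=.
    rewrite expr0 !mulr1; apply: le_trans (entry_norm_le a i) _.
    by rewrite lerDr.
  have := db i 0%N j; rewrite expr0 !mulr1 => /le_trans; apply.
  apply: ler_pM; rewrite ?mulr_ge0 ?exprn_ge0 //.
    apply: ler_pM; rewrite ?exprn_ge0 //; first by rewrite lerDl.
    by rewrite exprS ler_peMl ?exprn_ge0 // lerDr.
  by rewrite ler_nat factS leq_pmull.
have Ca0 : 0 <= C + `|a| by rewrite addr_ge0.
pose x t : 'rV[K]_n := \row_i exp_series (c i) t.
have x0 : x 0 = a.
  by apply/rowP => i; rewrite mxE (exp_series0 Ca0 M0' (cb i)).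
pose y t : 'rV[K]_n := \row_i exp_series (d i) t.
pose d0 := 4^-1 / M.
have d00 : 0 < d0 by rewrite divr_gt0 // invr_gt0.
have Md0 : M * d0 <= 4^-1 by rewrite /d0 mulrC divfK // gt_eqF.
have xy (t : K) : `|t| < d0 -> derivative_along setT x t (y t).
  move=> td; apply: derivative_along_row => i; rewrite mxE.
  under eq_fun do rewrite mxE.
  exact: exp_series_derive Ca0 M0' (cb i) Md0 td.
have nB : \forall t \near (0 : K), B (x t).
  have := derivative_along_continuous (N := B) (xy 0 _).
  rewrite normr0 x0 => /(_ d00 (open_nbhs_nbhs (conj oB Ba))).
  by apply: filterS => h; rewrite add0r; apply.
(* On discs with q |t| <= 1 the remainder term is at most eta / 2. *)
pose q := n%:R * C * M *+ 4.
have q0 : 0 <= q by rewrite mulrn_wge0 // !mulr_ge0.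
have n1 : \forall t \near (0 : K), `|t| < d0 by exact: (@nbhs0_lt K K).
have n2 : \forall t \near (0 : K), `|t| < (q + 1)^-1.
  by apply: (@nbhs0_lt K K); rewrite invr_gt0 ltr_wpDl.
have /nbhs_ballP[r /= r0 rP] : \forall t \near (0 : K),
    (B (x t) /\ `|t| < d0) /\ `|t| < (q + 1)^-1.
  exact: filterI (filterI nB n1) n2.
have {}rP t : `|t| < r -> [/\ B (x t), `|t| < d0 & q * `|t| <= 1].
  move=> tr; have [|[Bt td] tq] := rP t; first by rewrite /ball /= sub0r normrN.
  split=> //; have q1 : 0 < q + 1 by rewrite ltr_wpDl.
  apply: (@le_trans _ _ ((q + 1) * `|t|)); first by rewrite ler_wpM2r // lerDl.
  by rewrite mulrC -ler_pdivlMr // div1r ltW.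
(* Defects: e i 0 = 0 for all i is the equation x' = f(x). *)
pose e i m t := X m i (x t) - exp_series (fun j => d i (m + j)%N) t.
pose w i m t := \sum_(l < n) e l 0%N t * 'D_(delta_mx 0 l) (X m i) (x t).
have Mt (t : K) : `|t| < r -> M * `|t| <= 2^-1.
  move=> tr; have [_ td _] := rP t tr; apply: (@le_trans _ _ 4^-1).
    by apply: le_trans Md0; rewrite ler_wpM2l // ltW.
  by rewrite lef_pV2 ?posrE // ler_nat.
have eD i m (t : K) : `|t| < r -> derivative_along setT (e i m) t (e i m.+1 t -
  w i m t).
  move=> tr; have [Bt td _] := rP t tr; have Ut := BU _ Bt.
  have := derivative_alongB (chain_along (smooth_on_differentiable (sX m i) Ut)
    (xy t td))
    (exp_series_derive (Cm0 m) M0' (db i m) Md0 td).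
  apply: derivative_along_eq.
  rewrite (_ : (fun j => d i (m + j.+1)%N) = (fun j => d i (m.+1 + j)%N));
    last first.
    by apply/funext => j; rewrite addnS.
  rewrite /e [X m.+1 i (x t)](lie_derivativeE _ (sX m i) Ut).
  rewrite {1}(row_sum_delta (y t)) linear_sum /= addrAC -sumrB; congr (_ - _).
  apply: eq_bigr => l _; rewrite linearZ /= -deriveE; last first.
    exact: smooth_on_differentiable (sX m i) Ut.
  by rewrite /e /X /= -mulrBl opprB addrC subrK mxE.
have eB i m (t : K) : `|t| < r -> `|e i m t| <= C *+ 3 * M ^+ m * m`!%:R.
  move=> tr; have [Bt _ _] := rP t tr; apply: le_trans (ler_normB _ _) _.
  have -> : C *+ 3 * M ^+ m * m`!%:R =
      C * M ^+ m * m`!%:R + C * M ^+ m * m`!%:R * 2.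
    by rewrite [_ * 2]mulr_natr !mulrnAl -mulrS.
  have H := exp_series_le (Cm0 m) M0' (db i m) (Mt t tr).
  apply: lerD; last exact: H.
  clear H.
  have [H _] := HB i m _ Bt; apply: le_trans H _.
  by rewrite ler_wpM2r // ler_wpM2l // lerXn2r ?nnegrE.
have e0 i m : e i m 0 = 0.
  by rewrite /e x0 (exp_series0 (Cm0 m) M0' (db i m)) addn0 subrr.
have contract eta : 0 <= eta -> (forall i (t : K), `|t| < r -> `|e i 0%N t| <=
  eta) ->
    forall i (t : K), `|t| < r -> `|e i 0%N t| <= eta / 2.
  move=> eta0 eeta i t tr.
  pose P := n%:R * eta * C.
  have P0 : 0 <= P by rewrite !mulr_ge0.
  apply: (@le_geometric_eq0 _ _ _ (C *+ 3)); last 2 first.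
  - by rewrite mulrn_wge0.
  - by rewrite divr_ge0.
  move=> m.
  have := @taylor_estimate R k setT time_axisT (e i) (w i) 0 t (C *+ 3) P M
    Logic.I Logic.I
    (mulrn_wge0 3 C0) P0 M0' _ (e0 i) m.
  rewrite subr0 => H; apply: le_trans (H _) _.
    move=> s s01; rewrite add0r.
    have sr : `|of_real k s * t| < r by apply: le_lt_trans tr;
      exact: norm_segment_le.
    split=> j; [exact: eD|exact: eB|].
    apply: le_trans (ler_norm_sum _ _ _) _.
    apply: (@le_trans _ _ (\sum_(l < n) eta * (C * M ^+ j.+1 * (j.+1)`!%:R))).
      apply: ler_sum => l _; rewrite normrM; apply: ler_pM => //;
        first exact: eeta.
      have [Bs _ _] := rP _ sr; have [_ H1] := HB i j _ Bs.
      apply: le_trans (H1 l) _.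
      by rewrite ler_wpM2r // ler_wpM2l // lerXn2r ?nnegrE.
    by rewrite sumr_const card_ord -[_ *+ n]mulr_natl !mulrA.
  have Mt2 := Mt t tr.
  apply: lerD.
    rewrite ler_wpM2l ?mulrn_wge0 // lerXn2r ?nnegrE ?mulr_ge0 ?invr_ge0 //.
  apply: (@le_trans _ _ (P * (M * `|t| * 2))).
    rewrite ler_wpM2l //.
    under eq_bigr do rewrite exprS.
    rewrite -mulr_sumr ler_wpM2l ?mulr_ge0 //.
    apply: le_trans (@sum_half_le R k m); apply: ler_sum => j _.
    by rewrite lerXn2r ?nnegrE ?mulr_ge0 ?invr_ge0.
  have [_ _ qt] := rP t tr.
  have -> : P * (M * `|t| * 2) = q * `|t| * (eta / 2).
    exact: contraction_factorE.
  by rewrite ler_piMl // divr_ge0.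
have small p : forall i (t : K), `|t| < r -> `|e i 0%N t| <= C *+ 3 * 2^-1 ^+ p.
  elim: p => [|p IH] i t tr; first by have := eB i 0%N t tr;
    rewrite !expr0 !mulr1.
  rewrite exprSr mulrA; apply: contract => //.
  by rewrite mulr_ge0 ?mulrn_wge0 ?exprn_ge0 ?invr_ge0.
have ez i (t : K) : `|t| < r -> e i 0%N t = 0.
  move=> tr; apply/eqP; rewrite -normr_le0.
  apply: (@le_geometric_eq0 _ _ _ (C *+ 3)) => //; last by rewrite mulrn_wge0.
  by move=> p; rewrite addr0; exact: small.
exists r => //; exists x => // t tr; have [Bt td _] := rP t tr.
split; first exact: BU.
rewrite (_ : f (x t) = y t); first exact: xy.
by apply/rowP => i; rewrite mxE; apply/eqP; rewrite -subr_eq0; apply/eqP;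
  exact: ez.
Qed.

End Existence.

(** * Necessity and sufficiency *)

Lemma derivative_along_subset {K : numFieldType} {V : normedModType K} (T T' :
  set K)
    (x : K -> V) t v :
  T `<=` T' -> derivative_along T' x t v -> derivative_along T x t v.
Proof.
move=> TT' /derivative_along_near xv; apply/derivative_along_near => e /xv.
by apply: filterS => h H /TT' /H.
Qed.

Lemma time_ball_domain {R : realType} {k : scalar_kind} (T : set (scalars R k))
    (d : scalars R k) : time_axis T -> 0 < d -> time_domain T (ball 0 d `&` T).
Proof.
move=> tT d0.
have T0 : T 0 by rewrite -(rmorph0 (of_real k)); exact: time_axis_of_real.
have D0 : (ball 0 d `&` T) 0 by split=> //; exact: ballxx.
split; [by exists 0| |by exists (ball 0 d) => //; exact: ball_open].
pose seg (t : scalars R k) := (fun s : R => of_real k s * t) @` `[0, 1].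
have -> : ball 0 d `&` T = \bigcup_(t in ball 0 d `&` T) seg t.
  apply/seteqP; split=> [t Dt|u [t [td Tt] [s /=]]].
    by exists t => //; exists 1; rewrite ?rmorph1 ?mul1r //= in_itv /= ler01 lexx.
  rewrite in_itv /= => s01 <-; split; last exact: time_axisZ.
  move: td; rewrite /ball /= !sub0r !normrN; apply: le_lt_trans.
  exact: norm_segment_le.
apply: bigcup_connected.
  by exists 0 => t _; exists 0; rewrite ?rmorph0 ?mul0r //= in_itv /= ler01 lexx.
move=> t _; apply: connected_continuous_connected; first exact: segment_connected.
have segc : continuous (fun s : R => of_real k s * t).
  by move=> s; exact: (cvgM (@of_real_continuous R k s) (cvg_cst t)).
exact: continuous_subspaceT segc.
Qed.

Unset Implicit Arguments.

Theorem proposition1 (R : realType) (kind : scalar_kind)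
    (T : set (scalars R kind)) (n s : nat)
    (U : set 'rV[scalars R kind]_n)
    (f : 'rV[scalars R kind]_n -> 'rV[scalars R kind]_n)
    (gamma : 'I_s -> 'rV[scalars R kind]_n -> scalars R kind) :
  time_axis T ->
  open U ->
  smooth_on U f ->
  (forall j, smooth_on U (gamma j)) ->
  (admits_side_conditions T U f gamma -> lie_common_zeros U f gamma !=set0)
  /\
  ((analytic_on U f /\ forall j, analytic_on U (gamma j)) \/
   (polynomial_field_on U f /\ forall j, polynomial_on U (gamma j)) ->
   lie_common_zeros U f gamma !=set0 ->
   flow_invariant T U f (lie_common_zeros U f gamma) /\
   admits_side_conditions T U f gamma).
Proof.
move=> tT oU sf sg; split.
  move=> [D [x [tD xsol xz]]]; have [[t Dt] _ _] := tD.
  exists (x t); split; first by have [] := xsol t Dt.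
  move=> i j; apply: (side_condition_lie_zero tT oU sf tD xsol (sg j)) => // u Du.
  exact: xz.
move=> reg [a Wa]; have [Ua _] := Wa.
have [gf gg] : (forall b i, U b -> majorized_at U b (fun y => f y 0 i)) /\
    (forall b j, U b -> majorized_at U b (gamma j)).
  case: reg => -[rf rg]; split=> b i Ub.
  - by apply: analytic_majorized => //;
    [exact: smooth_on_coord|exact/analytic_coord/rf].
  - by apply: analytic_majorized => //; exact: rg.
  - by apply: polynomial_majorized => //; exact: rf.
  - by apply: polynomial_majorized => //; exact: rg.
have inv := lie_zeros_invariant tT oU sf gf sg gg.
split=> //.
have [d d0 [x x0 xsol]] := local_solution oU sf gf Ua.
pose D := ball 0 d `&` T.
have tD : time_domain T D by exact: time_ball_domain.
have Dsol : solution T D U f x.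
  move=> t [td _]; have [|Uxt xt] := xsol t; first by move: td;
    rewrite /ball /= sub0r normrN.
  by split=> //; exact: derivative_along_subset xt.
have D0 : D 0.
  by split; [exact: ballxx|rewrite -(rmorph0 (of_real kind));
    exact: time_axis_of_real].
exists D, x; split=> // t Dt j.
have [_ /(_ 0%N j)] := inv _ _ tD Dsol _ _ D0 Dt (eq_ind_r _ Wa x0).
exact.
Qed.
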